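(* Let $X$ and $Y$ be infinite-dimensional separable Banach spaces. Then there exists a co-analytic rank $\mathrm{r}_{\mathcal{S}}:\mathcal{SS}(X,Y)\to\omega_1$ on the co-analytic subset $\mathcal{SS}(X,Y)$ of the standard Borel space $\mathcal{L}(X,Y)$ such that $$\varrho(T)\leq \mathrm{r}_{\mathcal{S}}(T)$$ for every strictly singular operator $T:X\to Y$. In particular, the rank $\varrho$ satisfies boundedness; that is, if $\mathcal{A}$ is an analytic subset of $\mathcal{L}(X,Y)$ contained in $\mathcal{SS}(X,Y)$, then $\sup\{\varrho(T):T\in\mathcal{A}\}<\omega_1$.
   Context: All Banach spaces are real; ''operator'' means bounded linear operator; $\mathbb{N}=\{1,2,\dots\}$; $\omega_1$ is the first uncountable ordinal. $\mathcal{L}(X,Y)$ is the set of all operators from $X$ to $Y$. An operator $T:X\to Y$ between infinite-dimensional Banach spaces is strictly singular if its restriction to every infinite-dimensional subspace of $X$ is not an isomorphic embedding; $\mathcal{SS}(X,Y)$ is the set of all strictly singular operators from $X$ to $Y$. For separable $X,Y$, $\mathcal{L}(X,Y)$ is equipped with the $\sigma$-algebra of Borel sets of the strong operator topology; this makes it a standard Borel space, and $\mathcal{SS}(X,Y)$ is a co-analytic subset of it. A subset $A$ of a standard Borel space $\mathcal{X}$ is analytic if it is empty or the image of a Borel map $f:\mathbb{N}^{\mathbb{N}}\to \mathcal{X}$; it is co-analytic if its complement is analytic. Let $B$ be a co-analytic subset of a standard Borel space $\mathcal{X}$. A map $\varphi:B\to\omega_1$ is a co-analytic rank on $B$ if there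 are binary relations $\leq_\Sigma$ and $\leq_\Pi$ on $\mathcal{X}$, respectively analytic and co-analytic (as subsets of $\mathcal{X}\times\mathcal{X}$), such that for every $y\in B$ and every $x\in\mathcal{X}$: $(x\in B \text{ and } \varphi(x)\leq\varphi(y)) \Leftrightarrow x\leq_\Sigma y\Leftrightarrow x\leq_\Pi y$. Schreier families $\mathcal{S}_\xi$ ($1\leq\xi<\omega_1$) of finite subsets of $\mathbb{N}$: $\mathcal{S}_1=\{F\subseteq\mathbb{N} \text{ finite}: |F|\leq\min F\}$ (with $\varnothing\in\mathcal{S}_1$); $\mathcal{S}_{\xi+1}$ consists of $\varnothing$ and all sets $\bigcup_{i=1}^n F_i$ with $n\in\mathbb{N}$, $n\leq\min F_1$, $F_1<\dots<F_n$ and each $F_i\in\mathcal{S}_\xi$ non-empty, where $F<G$ means $\max F<\min G$; if $\xi$ is a limit ordinal, one fixes a strictly increasing sequence $(\xi_n)$ of ordinals with $1\le\xi_n<\xi$ and supremum $\xi$, and $\mathcal{S}_\xi$ consists of $\varnothing$ and all non-empty $F$ such that $F\in\mathcal{S}_{\xi_n}$ for some $n\leq\min F$. For $1\leq\xi<\omega_1$, an operator $T\in\mathcal{L}(X,Y)$ is $\mathcal{S}_\xi$-strictly singular if for every normalized basic sequence $(x_n)$ in $X$ and every $\varepsilon>0$ there exist a non-empty $F\in\mathcal{S}_\xi$ and a norm-one vector $x\in\mathrm{span}\{x_n:n\in F\}$ with $\|T(x)\|\leq\varepsilon$. Set $\varrho(T)=\inf\{\xi: T\text{ is }\mathcal{S}_\xi\text{-strictly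 singular}\}$ if $T$ is $\mathcal{S}_\xi$-strictly singular for some $1\leq\xi<\omega_1$, and $\varrho(T)=\omega_1$ otherwise. *)

(* Defs.v *)
From HB Require Import structures.
From mathcomp Require Import all_boot all_order all_algebra.
From mathcomp Require Import finmap.
From mathcomp Require Import all_classical all_reals all_analysis.
From mathcomp Require wochoice.

Set Implicit Arguments.
Unset Strict Implicit.
Unset Printing Implicit Defensive.

Import Order.TTheory GRing.Theory Num.Theory.
Import numFieldNormedType.Exports.

Local Open Scope classical_set_scope.
Local Open Scope ring_scope.

(* [omega1] is the set of the points of a well-ordering of the continuum
   [set nat] that have countably many predecessors: up to order isomorphism
   this is the first uncountable ordinal, as [omega1_least],
   [omega1_countable] and [omega1_uncountable] below confirm. *)
Definition wo_rel : rel (set nat) :=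
  projT1 (wochoice.well_ordering_principle (set nat)).

Definition omega1_pred : set (set nat) :=
  [set x | countable [set y | wo_rel y x]].

Definition omega1 : Type := set_type omega1_pred.

HB.instance Definition _ := Choice.on omega1.

Definition omega1_le (x y : omega1) : bool := wo_rel (\val x) (\val y).

Fact omega1_disp : Order.disp_t. Proof. exact: Order.Disp tt tt. Qed.

Lemma wo_relP (A : set (set nat)) : A !=set0 ->
  exists2 z, A z & forall x, A x -> wo_rel z x.
Proof.
move=> [x0 Ax0].
have [|z [[Az lbz] _]] := projT2 (wochoice.well_ordering_principle (set nat))
  [pred x | `[< A x >]].
  by exists x0; apply/asboolP.
exists z; first exact/asboolP.
by move=> x Ax; apply: lbz; apply/asboolP.
Qed.

Lemma wo_rel_total x y : wo_rel x y \/ wo_rel y x.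
Proof.
have [|z [->|->] zle] := @wo_relP [set x; y]; first by exists x; left.
  by left; apply: zle; right.
by right; apply: zle; left.
Qed.

Lemma wo_rel_refl x : wo_rel x x.
Proof. by have [] := wo_rel_total x x. Qed.

Lemma wo_rel_anti x y : wo_rel x y -> wo_rel y x -> x = y.
Proof.
move=> xy yx.
have [|z [_ uz]] := projT2 (wochoice.well_ordering_principle (set nat))
  [pred z | (z == x) || (z == y)].
  by exists x; rewrite inE eqxx.
have zx : z = x.
  apply: uz; split; first by rewrite inE eqxx.
  move=> t; rewrite inE => /orP[/eqP->|/eqP->] //; exact: wo_rel_refl.
rewrite -zx; apply: uz; split; first by rewrite inE eqxx orbT.
move=> t; rewrite inE => /orP[/eqP->|/eqP->] //; exact: wo_rel_refl.
Qed.

Lemma wo_rel_trans y x z : wo_rel x y -> wo_rel y z -> wo_rel x z.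
Proof.
move=> xy yz.
have [|t [[->|->]|->] tle] := @wo_relP [set x; y; z].
- by exists x; left; left.
- by apply: tle; right.
- by rewrite (wo_rel_anti xy (tle _ (or_introl (or_introl erefl)))).
- by rewrite -(wo_rel_anti yz (tle _ (or_introl (or_intror erefl)))).
Qed.

Lemma omega1_le_refl : reflexive omega1_le.
Proof. by move=> x; exact: wo_rel_refl. Qed.

Lemma omega1_le_anti : antisymmetric omega1_le.
Proof. by move=> x y /andP[xy yx]; apply/val_inj/wo_rel_anti. Qed.

Lemma omega1_le_trans : transitive omega1_le.
Proof. by move=> y x z; exact: wo_rel_trans. Qed.

Lemma omega1_le_total : total omega1_le.
Proof. by move=> x y; apply/orP; exact: wo_rel_total. Qed.

HB.instance Definition _ := Order.Le_isPOrder.Build omega1_disp omega1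
  omega1_le_refl omega1_le_anti omega1_le_trans.
HB.instance Definition _ :=
  Order.POrder_isTotal.Build omega1_disp omega1 omega1_le_total.

Lemma omega1_inhabited : exists _ : omega1, True.
Proof.
have [|z _ zle] := @wo_relP setT; first by exists set0.
suff zc : z \in omega1_pred by exists (exist _ z zc).
apply/mem_set; apply: (@sub_countable _ _ _ [set z]); last exact: countable1.
by apply: subset_card_le => y /= yz; apply: wo_rel_anti => //; exact: zle.
Qed.

HB.instance Definition _ :=
  isPointed.Build omega1 (projT1 (cid omega1_inhabited)).

Lemma omega1_least (A : set omega1) : A !=set0 ->
  exists2 x, A x & forall y, A y -> (x <= y)%O.
Proof.
move=> [a Aa].
have [|_ [x Ax <-] xle] := @wo_relP [set \val x | x in A].
  by exists (\val a); exists a.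
by exists x => // y Ay; apply: xle; exists y.
Qed.

Lemma omega1_countable (x : omega1) : countable [set y | (y <= x)%O].
Proof.
have /countable_injP[f fi] : countable [set y | wo_rel y (\val x)].
  exact: set_mem (valP x).
apply/countable_injP; exists (f \o val) => y z /set_mem/= yx /set_mem/= zx /= fyz.
by apply/val_inj/fi => //; apply/mem_set.
Qed.

Lemma omega1_uncountable : ~ countable [set: omega1].
Proof.
move=> cW.
have cP : countable omega1_pred.
  have -> : omega1_pred = [set \val x | x in [set: omega1]].
    apply/seteqP; split=> [x Px|_ [x _ <-]]; last exact: set_mem (valP x).
    by exists (exist _ x (mem_set Px)).
  exact: sub_countable (card_image_le _ _) cW.
have [Pall|/existsNP[x0 nx0]] := pselect (forall x, omega1_pred x).
  have /countable_injP[f fi] : countable [set: set nat].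
    by apply: sub_countable cP; apply: subset_card_le => x _; exact: Pall.
  pose D := [set n | exists2 A, f A = n & ~ A n].
  have [Df|nDf] := pselect (D (f D)).
    have [A fA nAD] := Df.
    suff AD : A = D by apply: nAD; rewrite AD.
    by apply: fi => //; apply/mem_set.
  by apply: (nDf); exists D.
have [|x nx xle] := @wo_relP (~` omega1_pred); first by exists x0.
apply: nx; apply: (@sub_countable _ _ _ (omega1_pred `|` [set x])).
  apply: subset_card_le => y /= yx.
  have [py|ny] := pselect (omega1_pred y); [by left|right].
  by apply: wo_rel_anti => //; exact: xle.
rewrite -bigcup2E; apply: bigcup_countable => // -[|[|i]] _ //=.
Qed.

(* The ordinals [<= omega_1]. *)
Definition omega1c : Type := option omega1.

HB.instance Definition _ := Choice.on omega1c.

Definition ord_countable (x : omega1) : omega1c := Some x.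
Definition ord_top : omega1c := None.
Coercion ord_countable : omega1 >-> omega1c.

Definition omega1c_le (a b : omega1c) : bool :=
  match a, b with
  | _, None => true
  | None, Some _ => false
  | Some x, Some y => (x <= y)%O
  end.

Lemma omega1c_le_refl : reflexive omega1c_le.
Proof. by case=> [x|] //=. Qed.

Lemma omega1c_le_anti : antisymmetric omega1c_le.
Proof. by move=> [x|] [y|] //= /le_anti ->. Qed.

Lemma omega1c_le_trans : transitive omega1c_le.
Proof. by move=> [y|] [x|] [z|] //=; exact: le_trans. Qed.

Lemma omega1c_le_total : total omega1c_le.
Proof. by move=> [x|] [y|] //=; exact: le_total. Qed.

HB.instance Definition _ := Order.Le_isPOrder.Build omega1_disp omega1c
  omega1c_le_refl omega1c_le_anti omega1c_le_trans.
HB.instance Definition _ :=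
  Order.POrder_isTotal.Build omega1_disp omega1c omega1c_le_total.

(* The default value of [xget] is used only when [A] is empty. *)
Definition ord_min (A : set omega1) : omega1 :=
  xget point [set x | A x /\ forall y, A y -> (x <= y)%O].

Definition ord_zero : omega1 := ord_min setT.
Definition ord_succ (x : omega1) : omega1 := ord_min [set y | (x < y)%O].
Definition ord_one : omega1 := ord_succ ord_zero.

Definition ord_limit (x : omega1) : Prop :=
  x <> ord_zero /\ forall y, x <> ord_succ y.

(* The infimum of a set of countable ordinals, equal to omega_1 for the empty
   set, and the supremum of a set of ordinals [<= omega_1]. *)
Definition ord_inf (A : set omega1) : omega1c :=
  if pselect (A !=set0) then ord_countable (ord_min A) else ord_top.

Definition ord_sup (A : set omega1c) : omega1c :=
  ord_inf [set x : omega1 | forall a, A a -> (a <= x :> omega1c)%O].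

(* Throughout, a sequence [(u_n)] indexed by n = 1, 2, 3, etc. is encoded by
   a function [u] on [nat] with [u_n = u n.-1], and a finite subset of
   {1, 2, 3, etc.} by an [{fset nat}]: the members of the Schreier families
   never contain [0]. *)
Definition fundamental_sequences (s : omega1 -> nat -> omega1) : Prop :=
  forall xi, ord_limit xi ->
    [/\ {homo s xi : m n / (m < n)%N >-> (m < n)%O},
        forall n, (ord_one <= s xi n < xi)%O
      & supremums (range (s xi)) xi].

(* max F < min G when F and G are non-empty. *)
Definition fset_lt (F G : {fset nat}) : Prop :=
  forall a b : nat, a \in F -> b \in G -> (a < b)%N.

(* n <= min F when F is non-empty. *)
Definition le_fset_min (n : nat) (F : {fset nat}) : Prop :=
  forall a : nat, a \in F -> (n <= a)%N.

Inductive schreier (s : omega1 -> nat -> omega1) :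
    omega1 -> {fset nat} -> Prop :=
| schreier_one F of le_fset_min #|` F| F :
    schreier s ord_one F
| schreier_empty xi of (ord_one <= xi)%O :
    schreier s xi fset0
| schreier_succ xi n (G : 'I_n.+1 -> {fset nat})
    of (ord_one <= xi)%O
     & le_fset_min n.+1 (G ord0)
     & (forall i j : 'I_n.+1, (i < j)%N -> fset_lt (G i) (G j))
     & (forall i, G i != fset0)
     & (forall i, schreier s xi (G i)) :
    schreier s (ord_succ xi) (\big[fsetU/fset0]_(i < n.+1) G i)%fset
| schreier_lim xi n F
    of ord_limit xi
     & F != fset0
     & le_fset_min n.+1 F
     & schreier s (s xi n) F :
    schreier s xi F.

Section Spans.
Variables (R : realType) (X : lmodType R).

Definition lspan (A : set X) : set X :=
  [set v | exists n (a : 'I_n -> R) (u : 'I_n -> X),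
    (forall i, A (u i)) /\ v = \sum_(i < n) a i *: u i].

Definition linear_subspace (V : set X) : Prop :=
  V 0 /\ forall (a : R) (u v : X), V u -> V v -> V (a *: u + v).

Definition finite_dimensional (V : set X) : Prop :=
  exists2 A, finite_set A & V = lspan A.

End Spans.

Definition separable (T : topologicalType) : Prop :=
  exists2 D : set T, countable D & dense D.

Section Operators.
Variables (R : realType) (X Y : completeNormedModType R).

(* A set of functions in the topology of pointwise convergence: the subtype
   that it coerces to carries the strong operator topology. *)
Definition operators : set {ptws X -> Y} :=
  [set T : X -> Y | linear T /\ exists M : R, forall x, `|T x| <= M * `|x|].

Lemma operators_zero : (cst 0 : {ptws X -> Y}) \in operators.
Proof.
apply/mem_set; split; first by move=> a u v; rewrite /cst scaler0 addr0.
by exists 0 => x; rewrite normr0 mul0r.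
Qed.

HB.instance Definition _ := isPointed.Build operators
  (exist _ (cst 0 : {ptws X -> Y}) operators_zero).

Definition iso_embedding_on (V : set X) (T : X -> Y) : Prop :=
  exists c C : R, [/\ 0 < c, 0 < C &
    forall x, V x -> c * `|x| <= `|T x| <= C * `|x|].

Definition strictly_singular (T : X -> Y) : Prop :=
  forall V : set X, linear_subspace V -> ~ finite_dimensional V ->
    ~ iso_embedding_on V T.

Definition basic_sequence (x : nat -> X) : Prop :=
  forall v, closure (lspan (range x)) v ->
    exists! a : nat -> R, series (fun k => a k *: x k) @ \oo --> v.

Definition schreier_strictly_singular (s : omega1 -> nat -> omega1)
    (xi : omega1) (T : X -> Y) : Prop :=
  forall x : nat -> X, (forall n, `|x n| = 1) -> basic_sequence x ->
  forall e : R, 0 < e ->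
  exists F : {fset nat}, [/\ F != fset0, schreier s xi F &
    exists v, [/\ lspan [set x n.-1 | n in [set` F]] v,
                  `|v| = 1 & `|T v| <= e]].

Definition rho (s : omega1 -> nat -> omega1) (T : X -> Y) : omega1c :=
  ord_inf [set xi | (ord_one <= xi)%O /\ schreier_strictly_singular s xi T].

End Operators.

Arguments operators {R} X Y.

Notation borelType T := (g_sigma_algebraType (@open T)).

Definition opspace (R : realType) (X Y : completeNormedModType R) :=
  borelType (operators X Y).

HB.instance Definition _ (R : realType) (X Y : completeNormedModType R) :=
  Measurable.on (opspace X Y).

Definition op_fun (R : realType) (X Y : completeNormedModType R)
  (T : opspace X Y) : X -> Y := \val T.

Definition SS (R : realType) (X Y : completeNormedModType R) :
  set (opspace X Y) := [set T | strictly_singular (op_fun T)].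

Arguments SS {R} X Y.

Section DescriptiveSetTheory.
Variables (d : measure_display) (T : measurableType d).

Definition analytic (A : set T) : Prop :=
  A = set0 \/ exists2 f : borelType {ptws nat -> nat} -> T,
    measurable_fun setT f & A = range f.

Definition coanalytic (A : set T) : Prop := analytic (~` A).

(* [P] is a Polish space; [f] is an isomorphism of [T] with the Borel
   structure of [P]. *)
Definition standard_borel (R : realType) : Prop :=
  exists (P : completePseudoMetricType R) (f : T -> P),
    [/\ hausdorff_space P, separable P, bijective f &
        @measurable _ T = [set f @^-1` B | B in <<s @open P >>]].

End DescriptiveSetTheory.

Definition coanalytic_rank (R : realType) d (T : measurableType d)
    (B : set T) (phi : B -> omega1) : Prop :=
  [/\ standard_borel T R, coanalytic B &
    exists leS leP : set (T * T), [/\ analytic leS, coanalytic leP &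
      forall (y : B) (x : T),
        ((exists2 x' : B, \val x' = x & (phi x' <= phi y)%O) <->
           leS (x, \val y)) /\
        (leS (x, \val y) <-> leP (x, \val y))]].

(* Main.v *)
(* An operator [T] fails to be strictly singular iff it is bounded below on the
   span of a linearly independent sequence. Searching for such a sequence
   through finer and finer approximations by members of a countable dense set
   gives a tree [ss_tree T] on the natural numbers, each of whose nodes imposes
   a closed condition on [T], and [T] is strictly singular iff the tree is well
   founded. The rank of the tree is a co-analytic rank: comparing ranks of trees
   amounts to the existence of maps between trees preserving lengths and
   inclusions. If [T] is not S_xi-strictly singular, then the tree contains a
   copy of the Schreier family S_xi, whose rank is at least [xi], and so
   [rho T] is at most the rank of the tree. Boundedness on an analytic set is
   the Kunen-Martin argument: the trees of all its points embed into a single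
   countable well-founded tree. *)
Require Import Defs.
From HB Require Import structures.
From mathcomp Require Import all_boot all_order all_algebra.
From mathcomp Require Import finmap.
From mathcomp Require Import all_classical all_reals all_analysis.
From mathcomp Require Import ring.

Set Implicit Arguments.
Unset Strict Implicit.
Unset Printing Implicit Defensive.

Import Order.TTheory GRing.Theory Num.Theory.
Import numFieldNormedType.Exports.

Local Open Scope classical_set_scope.
Local Open Scope ring_scope.

(** * Countable ordinals *)

(** Two obstacles shape the proof. The strong operator topology on the whole space of operators need
    not be Polish, so standardness is obtained from a finer complete separable metric with the same
    Borel sets. Standardness then supplies a Borel surjection from the Baire space, through which
    projections of Borel sets become images of Borel maps. Secondly, linear independence is lost
    when approximations pass to a limit; it is replaced by inequalities on coefficients ([spread]),
    which survive limits and can be tested approximately at finite stages. The first letter of a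
    node of [ss_tree] fixes the lower bound of the operator. A copy of a Schreier family therefore
    sits above a node of length one, whose rank is strictly below that of the root. This strictness
    gives [rho T] at most the rank, with no successor added. *)

Lemma ord_minP (A : set omega1) : A !=set0 ->
  A (ord_min A) /\ forall y, A y -> (ord_min A <= y)%O.
Proof.
move=> /omega1_least[x Ax xle].
by apply: (@xgetPex _ point [set x | A x /\ forall y, A y -> (x <= y)%O]); exists x.
Qed.

(** Otherwise [omega1] would be a countable union of countable initial segments. *)
Lemma omega1_ub_strict (f : nat -> omega1) :
  exists z, forall n, (f n < z)%O.
Proof.
apply: contrapT => /forallNP nz.
apply: omega1_uncountable; apply: (@sub_countable _ _ _
  (\bigcup_(n in [set: nat]) [set y | (y <= f n)%O])); last first.
  apply: bigcup_countable => [|n _]; first exact: countableP.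
  exact: omega1_countable.
apply: subset_card_le => z _; have /existsNP[n /negP] := nz z.
by rewrite -leNgt => zn; exists n.
Qed.

Lemma ord_zero_le x : (ord_zero <= x)%O.
Proof. by have [|_] := @ord_minP setT; [exists point|exact]. Qed.

Lemma ord_succ_ltP x y : (x < y)%O <-> (ord_succ x <= y)%O.
Proof.
have [|sx sle] := @ord_minP [set y | (x < y)%O].
  by have [z zP] := omega1_ub_strict (fun=> x); exists z; exact: zP 0%N.
by split=> [xy|]; [exact: sle|exact: lt_le_trans].
Qed.

Lemma ord_succ_gt x : (x < ord_succ x)%O.
Proof. exact/ord_succ_ltP. Qed.

Lemma omega1_ind (P : omega1 -> Prop) :
  (forall x, (forall y, (y < x)%O -> P y) -> P x) -> forall x, P x.
Proof.
move=> IH x; apply: contrapT => nPx.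
have [|z nPz zle] := @omega1_least [set x | ~ P x]; first by exists x.
apply: nPz; apply: IH => y yz; apply: contrapT => /zle.
by rewrite leNgt yz.
Qed.

Lemma ord_trichotomy x :
  [\/ x = ord_zero, exists2 y, (y < x)%O & x = ord_succ y | ord_limit x].
Proof.
have [->|x0] := pselect (x = ord_zero); first by constructor 1.
have [[y xy]|/forallNP ns] := pselect (exists y, x = ord_succ y).
  by constructor 2; exists y => //; rewrite xy ord_succ_gt.
by constructor 3.
Qed.

Lemma ord_one_leP x : (ord_one <= x)%O <-> x <> ord_zero.
Proof.
rewrite /ord_one -ord_succ_ltP lt_neqAle ord_zero_le andbT; split.
  by move=> /eqP + /esym.
by move=> + ; move=> xn; apply/eqP => /esym.
Qed.

(** * Trees on the natural numbers *)

Definition is_tree (W : set (seq nat)) : Prop :=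
  W [::] /\ forall p a, W (rcons p a) -> W p.

Definition wf_tree (W : set (seq nat)) : Prop :=
  ~ exists b : nat -> nat, forall n, W (mkseq b n).

(** The rank of a node is the least strict upper bound of the ranks of its children, stated as an
    adjunction. In a tree, the leaves and the sequences outside the tree get rank [ord_zero]. *)
Definition is_rank (W : set (seq nat)) (rk : seq nat -> omega1) : Prop :=
  forall p z, (rk p <= z)%O <->
    forall a, W (rcons p a) -> (rk (rcons p a) < z)%O.

Definition tree_rank (W : set (seq nat)) : omega1 :=
  xget (fun=> point) [set rk | is_rank W rk] [::].

(** The general form of a map preserving lengths and inclusions: [phi p] is the last letter of the
    image of a nonempty [p]. *)
Definition seq_map (phi : seq nat -> nat) (p : seq nat) : seq nat :=
  mkseq (fun j => phi (take j.+1 p)) (size p).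

Lemma eq_in_mkseq (T : Type) (f g : nat -> T) n :
  (forall j, (j < n)%N -> f j = g j) -> mkseq f n = mkseq g n.
Proof. by move=> fg; apply/eq_in_map => j; rewrite mem_iota => /fg. Qed.

Lemma seq_map_rcons phi p a :
  seq_map phi (rcons p a) = rcons (seq_map phi p) (phi (rcons p a)).
Proof.
rewrite /seq_map size_rcons mkseqS take_oversize ?size_rcons//; congr rcons.
by apply: eq_in_mkseq => j jp; rewrite -cats1 takel_cat.
Qed.

Lemma seq_map_mkseq phi b n :
  seq_map phi (mkseq b n) = mkseq (fun j => phi (mkseq b j.+1)) n.
Proof. by elim: n => // n IH; rewrite !mkseqS seq_map_rcons IH -mkseqS. Qed.

Lemma tree_take W p n : is_tree W -> W p -> W (take n p).
Proof.
move=> [_ Wr]; elim/last_ind: p => [|p a IH] // Wpa.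
have [np|] := leqP n (size p).
  by rewrite -cats1 takel_cat//; exact/IH/(Wr _ a).
by move=> pn; rewrite take_oversize// size_rcons.
Qed.

Section rank_existence.
Variables (W : set (seq nat)) (tW : is_tree W) (wW : wf_tree W).

Let child q p := exists2 a, q = rcons p a & W q.

(** A sequence that is not accessible has a child in [W] that is not accessible either. Iterating
    this choice gives a chain of sequences, whose diagonal is an infinite branch of [W]. *)
Let child_wf : well_founded child.
Proof.
move=> p0; apply: contrapT => np0.
have /choice[next nextP] : forall p, exists a, ~ Acc child p ->
    W (rcons p a) /\ ~ Acc child (rcons p a).
  move=> p; have [|np] := pselect (Acc child p); first by exists 0%N.
  apply: contrapT => /forallNP h; apply: np; constructor => _ [a -> Wa].
  by apply: contrapT => nacc; apply: (h a).
pose u n := iter n (fun p => rcons p (next p)) p0.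
have nu n : ~ Acc child (u n).
  by elim: n => // n /nextP[].
have Wu n : W (u n.+1) by have [] := nextP _ (nu n).
have su n : size (u n) = (size p0 + n)%N.
  by elim: n => [|n IH]; rewrite ?addn0//= size_rcons IH addnS.
have tu n m : (n <= size (u m))%N -> take n (u m.+1) = take n (u m).
  by move=> nm /=; rewrite -cats1 takel_cat.
have tu' n m : (n <= m)%N -> take n (u m) = take n (u n).
  elim: m => [|m IH]; first by rewrite leqn0 => /eqP ->.
  rewrite leq_eqVlt => /predU1P[->//|]; rewrite ltnS => nm.
  by rewrite tu ?IH// su (leq_trans nm)// leq_addl.
apply: wW; exists (fun n => nth 0%N (u n.+1) n) => n.
suff -> : mkseq (fun k => nth 0%N (u k.+1) k) n = take n (u n).
  by rewrite -(tu' _ n.+1)//; exact: tree_take.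
apply: (@eq_from_nth _ 0%N).
  by rewrite size_mkseq size_takel// su leq_addl.
move=> k; rewrite size_mkseq => kn; rewrite nth_mkseq// nth_take//.
by rewrite -(@nth_take k.+1)// -(tu' k.+1 n)// nth_take.
Qed.

Lemma rank_exists : exists rk, is_rank W rk.
Proof.
pose F p (rec : forall q, child q p -> omega1) : omega1 :=
  ord_min [set z | forall a (h : W (rcons p a)),
    (rec (rcons p a) (ex_intro2 _ _ a erefl h) < z)%O].
pose rk := Fix child_wf (fun=> omega1) F.
have rkE p : rk p = ord_min [set z | forall a (h : W (rcons p a)),
    (rk (rcons p a) < z)%O].
  rewrite /rk Fix_eq// => x f g fg; rewrite /F; congr ord_min.
  apply/seteqP; split=> z zP a h; first by rewrite -fg.
  by rewrite fg.
exists rk => p z; have [|minP minle] := @ord_minP [set z | forall a (h : W (rcons p a)),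
    (rk (rcons p a) < z)%O].
  (* A node has countably many children, so the minimum defining [rk p] is taken over a nonempty
     set. *)
  have [z0 z0P] := omega1_ub_strict (fun a => rk (rcons p a)).
  by exists z0 => a _; exact: z0P.
rewrite -rkE in minP minle; split=> [pz a Wa|]; last exact: minle.
by apply: lt_le_trans pz; exact: minP.
Qed.

Lemma tree_rankP : exists2 rk, is_rank W rk & tree_rank W = rk [::].
Proof.
exists (xget (fun=> point) [set rk | is_rank W rk]) => //.
have [rk rkP] := rank_exists.
exact: (@xgetPex _ (fun=> point) [set rk | is_rank W rk] (ex_intro _ rk rkP)).
Qed.

End rank_existence.

Section rank_comparison.
Variables (W : set (seq nat)) (rk : seq nat -> omega1).
Hypothesis rkW : is_rank W rk.

Lemma is_rank_lt p a : W (rcons p a) -> (rk (rcons p a) < rk p)%O.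
Proof. by have [+ _] := rkW p (rk p); apply. Qed.

Lemma is_rank_ex p z : (z < rk p)%O ->
  exists2 a, W (rcons p a) & (z <= rk (rcons p a))%O.
Proof.
move=> zp; apply: contrapT => h; have : (rk p <= z)%O.
  apply/rkW => a Wa; rewrite ltNge; apply/negP => za; apply: h.
  by exists a.
by rewrite leNgt zp.
Qed.

End rank_comparison.

(** Induction on the rank of [p]: the map sends children to children. The image [c] of the root is a
    parameter because a root sent to a node of length one yields a strict inequality between tree
    ranks. *)
Lemma rank_le_of_map W W' rk rk' c phi : is_rank W rk -> is_rank W' rk' ->
  (forall p, W p -> W' (c ++ seq_map phi p)) ->
  forall p, (rk p <= rk' (c ++ seq_map phi p))%O.
Proof.
move=> rkW rkW' WW' p; move: {-1}(rk p) (erefl (rk p)) => x.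
elim/omega1_ind: x p => x IH p px; rewrite -px.
apply/rkW => a Wa; apply: (@le_lt_trans _ _ (rk' (c ++ seq_map phi (rcons p a)))).
  by apply: (IH _ _ (rcons p a)) => //; rewrite -px; exact: is_rank_lt.
rewrite seq_map_rcons -rcons_cat; apply: (is_rank_lt rkW').
by rewrite rcons_cat -seq_map_rcons; exact: WW'.
Qed.

(** The map is built greedily, keeping the rank of [p] at most that of its image. A child of [p] has
    rank below that of the image, which therefore has a child of at least that rank; [next] picks
    it. *)
Lemma map_of_rank_le W W' rk rk' c : is_tree W -> is_rank W rk ->
  is_rank W' rk' -> W' c -> (rk [::] <= rk' c)%O ->
  exists phi, forall p, W p -> W' (c ++ seq_map phi p).
Proof.
move=> tW rkW rkW' Wc rkc.
have /choice[next nextP] : forall qz : seq nat * omega1, exists a,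
    (qz.2 < rk' qz.1)%O -> W' (rcons qz.1 a) /\ (qz.2 <= rk' (rcons qz.1 a))%O.
  move=> [q z] /=; have [h|] := boolP (z < rk' q)%O; last by exists 0%N.
  by have [a Wa za] := is_rank_ex rkW' h; exists a.
pose step pq a := (rcons pq.1 a, rcons pq.2 (next (pq.2, rk (rcons pq.1 a)))).
pose st p := foldl step ([::], c) p.
have st1 p : (st p).1 = p.
  by elim/last_ind: p => // p a IH; rewrite /st foldl_rcons /= -/(st p) IH.
have stS p a : (st (rcons p a)).2 = rcons (st p).2 (next ((st p).2, rk (rcons p a))).
  by rewrite /st foldl_rcons /= -/(st p) st1.
exists (fun p => last 0%N (st p).2).
have stE p : c ++ seq_map (fun p => last 0%N (st p).2) p = (st p).2.
  elim/last_ind: p => [|p a IH]; first by rewrite cats0.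
  by rewrite seq_map_rcons -rcons_cat IH stS last_rcons.
move=> p Wp; rewrite stE.
suff [] : W' (st p).2 /\ (rk p <= rk' (st p).2)%O by [].
elim/last_ind: p Wp => // p a IH Wpa; rewrite stS.
have [Wst rkst] := IH (tW.2 _ _ Wpa).
apply: (nextP ((st p).2, rk (rcons p a))) => /=.
by apply: lt_le_trans rkst; exact: is_rank_lt.
Qed.

(* [al] codes a map of trees preserving lengths and inclusions: the last letter
   of the image of [p] is [al (choice.pickle p)]. *)
Definition tree_map (al : nat -> nat) (p : seq nat) : seq nat :=
  seq_map (al \o choice.pickle) p.

Definition tree_le (W W' : set (seq nat)) (al : nat -> nat) : Prop :=
  forall p, W p -> W' (tree_map al p).

Definition tree_lt (W W' : set (seq nat)) (al : nat -> nat) : Prop :=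
  forall p, W p -> W' (al (choice.pickle ([::] : seq nat)) :: tree_map al p).

(** Well-foundedness is assumed of [W'] only: a map into a well-founded tree forces [W] to be well
    founded, since it would carry a branch to a branch. This asymmetry is the one in the definition
    of a co-analytic rank. *)
Lemma tree_leP W W' : is_tree W -> is_tree W' -> wf_tree W' ->
  (wf_tree W /\ (tree_rank W <= tree_rank W')%O) <-> exists al, tree_le W W' al.
Proof.
move=> tW tW' wW'; have [rk' rkW' ->] := tree_rankP tW' wW'.
split=> [[wW]|[al WW']].
  have [rk rkW ->] := tree_rankP tW wW => rkle.
  have [phi phiP] := map_of_rank_le tW rkW rkW' tW'.1 rkle.
  exists (fun n => phi (odflt [::] (choice.unpickle n))) => p Wp.
  rewrite /tree_map [seq_map _ _](_ : _ = seq_map phi p); first exact: phiP.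
  by apply: eq_mkseq => j; rewrite /comp choice.pickleK.
have wW : wf_tree W.
  move=> [b Wb]; apply: wW'; exists (fun j => (al \o choice.pickle) (mkseq b j.+1)) => n.
  by rewrite -seq_map_mkseq; exact: WW'.
split=> //; have [rk rkW ->] := tree_rankP tW wW.
exact: (@rank_le_of_map W W' rk rk' [::] (al \o choice.pickle)).
Qed.

Lemma tree_ltP W W' : is_tree W -> is_tree W' -> wf_tree W ->
  ~ (wf_tree W' /\ (tree_rank W' <= tree_rank W)%O) <-> exists al, tree_lt W W' al.
Proof.
move=> tW tW' wW; have [rk rkW ->] := tree_rankP tW wW.
(* The extra first letter is stored at the code of the empty sequence, a place that [tree_map] never
   reads. *)
pose code a (phi : seq nat -> nat) n := let p := odflt [::] (choice.unpickle n) in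
  if p is [::] then a else phi p.
have codeE a phi p : tree_map (code a phi) p = seq_map phi p.
  apply: eq_in_mkseq => j jp; rewrite /comp /code choice.pickleK.
  by case: p jp => //.
have code0 a phi : code a phi (choice.pickle ([::] : seq nat)) = a.
  by rewrite /code choice.pickleK.
split=> [|[al WW'] [wW']].
  have [wW' /not_andP[//|/negP]|/contrapT[b Wb] _] := pselect (wf_tree W').
    have [rk' rkW' ->] := tree_rankP tW' wW'.
    rewrite -ltNge => /(is_rank_ex rkW')[a Wa rka].
    have [phi phiP] := map_of_rank_le tW rkW rkW' Wa rka.
    by exists (code a phi) => p Wp; rewrite code0 codeE; exact: phiP.
  (* An ill-founded [W'] receives every tree along its branch [b]. *)
  exists (code (b 0%N) (fun p => b (size p))) => p Wp; rewrite code0 codeE.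
  rewrite [_ :: _](_ : _ = mkseq b (size p).+1)//.
  apply: (@eq_from_nth _ 0%N) => [|i]; rewrite /= !size_map !size_iota// ltnS => ip.
  rewrite (nth_mkseq _ _ (_ : i < (size p).+1)%N)//.
  by case: i ip => //= i ip; rewrite nth_mkseq// size_takel.
have [rk' rkW' ->] := tree_rankP tW' wW'; apply/negP; rewrite -ltNge.
have /= := @rank_le_of_map W W' rk rk' [:: al (choice.pickle ([::] : seq nat))] (al \o choice.pickle)
  rkW rkW' WW' [::].
move=> /le_lt_trans; apply; apply: (@is_rank_lt _ _ rkW' [::]).
exact: (WW' [::] tW.1).
Qed.

(** * The Baire space *)

Definition agree (n : nat) (a a' : nat -> nat) : Prop :=
  forall i, (i < n)%N -> a i = a' i.

Lemma agree_sym n a a' : agree n a a' -> agree n a' a.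
Proof. by move=> aa' i /aa'. Qed.

Lemma agree_trans n a a' a'' : agree n a a' -> agree n a' a'' -> agree n a a''.
Proof. by move=> aa' aa'' i ni; rewrite aa'// aa''. Qed.

Lemma agree_le m n a a' : (m <= n)%N -> agree n a a' -> agree m a a'.
Proof. by move=> mn aa' i im; apply: aa'; exact: leq_trans mn. Qed.

Lemma ptws_eval_continuous (U : topologicalType) (V : uniformType) (t : U) :
  continuous (fun f : {ptws U -> V} => f t).
Proof.
move=> f; have /pointwise_cvgP h : {ptws, nbhs (f : {ptws U -> V}) --> f} by exact: cvg_id.
exact: h.
Qed.

Lemma baire_coord_open (P : set nat) i : open [set a : {ptws nat -> nat} | P (a i)].
Proof.
apply: (continuousP _).1 (discrete_open P).
exact: (@ptws_eval_continuous nat nat).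
Qed.

Lemma baire_openP (U : set {ptws nat -> nat}) :
  open U <-> forall a, U a -> exists n, forall a', agree n a a' -> U a'.
Proof.
split=> [oU a Ua|h].
  (* The filter of cylinders around [a] converges pointwise to [a], so each neighbourhood of [a]
     contains a cylinder. *)
  pose F : set_system (nat -> nat) :=
    filter_from [set: nat] (fun n => [set a' | agree n a a']).
  have FF : Filter F.
    apply: filter_from_filter; first by exists 0%N.
    move=> m n _ _; exists (maxn m n) => // a' aa'.
    by split; apply: agree_le aa'; rewrite ?leq_maxl ?leq_maxr.
  have : {ptws, F --> a}.
    apply/pointwise_cvgP => t A /= At; exists t.+1 => // a' /= /(_ t (ltnSn _)) aa'.
    by suff : A (a' t) by []; rewrite -aa'; exact: nbhs_singleton.
  move=> /(_ U)[|n _ nU]; last by exists n.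
  exact: open_nbhs_nbhs.
rewrite openE => a Ua; have [n nU] := h a Ua.
apply: (@filterS _ _ _ [set a' : {ptws nat -> nat} | agree n a a']); first exact: nU.
apply: open_nbhs_nbhs; split=> //.
elim: n {nU} => [|n IH].
  by rewrite [X in open X](_ : _ = setT); [exact: openT|apply/seteqP; split].
rewrite [X in open X](_ : _ = [set a' | agree n a a'] `&` [set a' | a n = a' n]).
  exact: (openI IH (baire_coord_open [set k | a n = k] n)).
apply/seteqP; split=> a' /= => [aa'|[aa' an] i].
  by split; [exact: agree_le aa'|exact: aa'].
by rewrite ltnS leq_eqVlt => /predU1P[->//|/aa'].
Qed.

(** * Souslin representations *)

Definition closed_rel (F : (nat -> nat) -> (nat -> nat) -> Prop) : Prop :=
  forall a b, (forall n, exists a' b', [/\ agree n a a', agree n b b' & F a' b']) ->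
    F a b.

(** Projections of closed sets. Closedness lets membership be tested on finite initial segments, as
    the nodes of [km_tree] require. *)
Definition souslin (B : set (nat -> nat)) : Prop :=
  exists F, closed_rel F /\ forall a, B a <-> exists b, F a b.

(** The witness announces at entry 0 the size of a cylinder around [a] contained in [U]. *)
Lemma souslin_open (U : set {ptws nat -> nat}) : open U -> souslin U.
Proof.
move=> /baire_openP oU.
exists (fun a b => forall a', agree (b 0%N) a a' -> U a'); split.
  move=> a b h a' aa'; have [a1 [b1 [aa1 bb1]]] := h (maxn (b 0%N) 1).
  apply; rewrite -bb1 ?leq_maxr//; apply: agree_trans aa'; apply: agree_sym.
  by apply: agree_le aa1; rewrite leq_maxl.
move=> a; split=> [/oU[n nU]|[b]]; first by exists (fun=> n).
by apply.
Qed.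

Lemma souslin_closed (U : set {ptws nat -> nat}) : open U -> souslin (~` U).
Proof.
move=> /baire_openP oU; exists (fun a _ => ~ U a); split.
  move=> a b h Ua; have [n nU] := oU a Ua.
  by have [a' [b' [aa' _]]] := h n; apply; exact: nU.
by move=> a; split=> [nU|[]//]; exists (fun=> 0%N).
Qed.

Lemma souslin_bigcup (B : nat -> set (nat -> nat)) :
  (forall n, souslin (B n)) -> souslin (\bigcup_n B n).
Proof.
move=> /choice[F /all_and2[cF FB]].
exists (fun a b => F (b 0%N) a (b \o S)); split.
  move=> a b h; apply: cF => n; have [a' [b' [aa' bb' Fab]]] := h n.+1.
  exists a', (b' \o S); split; first exact: agree_le aa'.
    by move=> i ni; exact: bb'.
  by rewrite (bb' 0%N).
move=> a; split=> [[n _ /FB[b Fab]]|[b /(proj2 (FB _ _) \o (ex_intro _ _)) Ba]].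
  by exists (fun i => if i is j.+1 then b j else n).
by exists (b 0%N).
Qed.

Lemma souslin_bigcap (B : nat -> set (nat -> nat)) :
  (forall n, souslin (B n)) -> souslin (\bigcap_n B n).
Proof.
move=> /choice[F /all_and2[cF FB]].
pose sec (b : nat -> nat) (k i : nat) := b (choice.pickle (k, i)).
exists (fun a b => forall k, F k a (sec b k)); split.
  move=> a b h k; apply: cF => n.
  (* Agreement this far covers the codes of all [(k, i)] with [i < n], hence the first [n] entries
     of section [k]. *)
  have [a' [b' [aa' bb' Fab]]] := h (n + \max_(i < n) (choice.pickle (k, val i)).+1)%N.
  exists a', (sec b' k); split; last exact: Fab.
    by apply: agree_le aa'; rewrite leq_addr.
  move=> i ni; apply: bb'; apply: ltn_addl.
  exact: (@leq_bigmax _ (fun j : 'I_n => (choice.pickle (k, val j)).+1) (Ordinal ni)).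
move=> a; split=> [Ba|[b Fab] k _]; last by apply/FB; exists (sec b k).
have /choice[b Fb] : forall k, exists b, F k a b by move=> k; exact/FB/Ba.
exists (fun n => let ki := odflt (0, 0)%N (choice.unpickle n) in b ki.1 ki.2) => k.
rewrite (_ : sec _ _ = b k)//.
by apply/funext => i; rewrite /sec choice.pickleK.
Qed.

Local Notation baire := (borelType {ptws nat -> nat}).

(** Souslin sets are not closed under complements, but the sets that are Souslin together with their
    complement form a sigma-algebra. *)
Lemma souslin_measurable (B : set baire) : measurable B -> souslin B.
Proof.
move=> mB; suff : [set A : set baire | souslin A /\ souslin (~` A)] B by case.
apply: (smallest_sub _ _ mB) => [|U oU]; last first.
  by split; [exact: souslin_open|exact: souslin_closed].
split=> /=.
- split; first exact: (@souslin_open set0 open0).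
  by rewrite setC0; exact: (@souslin_open setT openT).
- by move=> A [sA sCA]; rewrite setTD setCK.
move=> A sA; split; first by apply: souslin_bigcup => n; case: (sA n).
by rewrite setC_bigcup; apply: souslin_bigcap => n; case: (sA n).
Qed.

(** * Boundedness *)

Section kunen_martin.
Variable F : seq nat -> (nat -> nat) -> (nat -> nat) -> Prop.

(* A matrix [G] of natural numbers is coded by a sequence whose [j]-th term is
   the corner of [G] of size [j.+1]. *)
Definition corner (G : nat -> nat -> nat) (j : nat) : nat :=
  choice.pickle (mkseq (fun i => mkseq (G i) j.+1) j.+1).

(** Each entry is read from the smallest corner that contains it. The first [n] terms thus determine
    an [n] by [n] block for any [b], without requiring successive corners to be coherent. *)
Definition uncorner (b : nat -> nat) (i l : nat) : nat :=
  nth 0%N (nth [::] (odflt [::] (choice.unpickle (b (maxn i l)))) i) l.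

Lemma uncornerE G b i l : b (maxn i l) = corner G (maxn i l) ->
  uncorner b i l = G i l.
Proof.
rewrite /uncorner => ->; rewrite choice.pickleK.
rewrite (nth_mkseq [::]) ?ltnS ?leq_maxl//.
by rewrite (nth_mkseq 0%N) ?ltnS ?leq_maxr.
Qed.

Lemma uncorner_eq b b' n i l : agree n b b' -> (i < n)%N -> (l < n)%N ->
  uncorner b i l = uncorner b' i l.
Proof. by move=> bb' ni nl; rewrite /uncorner bb'// gtn_max ni. Qed.

(* The rows of the matrix [G] coded by a branch are a point [a], a sequence
   [p], and for each [i] a witness that [a] satisfies the closed relation
   attached to the initial segment of [p] of length [i]. *)
Definition km_node (b : nat -> nat) (n : nat) : Prop :=
  forall i, (i.+2 < n)%N -> exists a' b',
    [/\ agree n (uncorner b 0%N) a', agree n (uncorner b i.+2) b' &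
        F (mkseq (uncorner b 1%N) i) a' b'].

Definition km_tree : set (seq nat) :=
  [set p | km_node (nth 0%N p) (size p)].

Lemma km_node_le b b' m n : agree m b b' -> (m <= n)%N ->
  km_node b n -> km_node b' m.
Proof.
move=> bb' mn h i im; have m0 : (0 < m)%N by exact: leq_trans im.
have m1 : (1 < m)%N by exact: leq_trans im.
have [a1 [b1 [aa1 bb1 Fab]]] := h i (leq_trans im mn).
exists a1, b1; split.
- by move=> l lm; rewrite -(uncorner_eq bb')//; apply: aa1; exact: leq_trans mn.
- by move=> l lm; rewrite -(uncorner_eq bb')//; apply: bb1; exact: leq_trans mn.
- rewrite (_ : mkseq _ i = mkseq (uncorner b 1%N) i)//; apply: eq_in_mkseq => l li.
  by rewrite -(uncorner_eq bb')// (ltn_trans li (ltnW (ltnW im))).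
Qed.

Lemma km_tree_tree : is_tree km_tree.
Proof.
split=> [|p x]; first by move=> i.
apply: km_node_le; last by rewrite size_rcons.
by move=> i ip; rewrite nth_rcons ip.
Qed.

Lemma km_tree_mkseq b n : km_tree (mkseq b n) -> km_node b n.
Proof.
rewrite /km_tree /= size_mkseq; apply: km_node_le => // i ni.
by rewrite nth_mkseq.
Qed.

End kunen_martin.

Lemma tree_rank_bounded (W : (nat -> nat) -> set (seq nat)) :
  (forall a, is_tree (W a)) -> (forall a, wf_tree (W a)) ->
  (forall p, souslin [set a | W a p]) ->
  exists xi, forall a, (tree_rank (W a) <= xi)%O.
Proof.
move=> tW wW /choice[F /all_and2[cF FW]].
(* The rows of a branch would be a point, a sequence, and limits of approximate witnesses; since the
   relations are closed, the sequence would be a branch of the tree of that point. *)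
have wT : wf_tree (km_tree F).
  move=> [b Tb]; apply: (wW (uncorner b 0%N)); exists (uncorner b 1%N) => i.
  apply/FW; exists (uncorner b i.+2); apply: cF => n.
  have /km_tree_mkseq/(_ i) := Tb (n + i.+3)%N.
  rewrite leq_addl => /(_ isT)[a' [b' [aa' bb' Fab]]]; exists a', b'.
  by split=> //; [apply: agree_le aa'|apply: agree_le bb']; rewrite leq_addr.
exists (tree_rank (km_tree F)) => a.
have [rkT rkTP ->] := tree_rankP (km_tree_tree F) wT.
have [rk rkP ->] := tree_rankP (tW a) (wW a).
have /choice[B FB] : forall p, exists b, W a p -> F p a b.
  by move=> p; have [/FW[b Fb]|] := pselect (W a p); [exists b|exists (fun=> 0%N)].
(* The witness in row [i.+2] depends only on the prefix of length [i]. Corners computed from a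
   prefix of [p] are therefore those of [G p], and [p] maps to a sequence of corners compatibly with
   inclusions. *)
pose G p i l := match i with
  | 0 => a l | 1 => nth 0%N p l | i.+2 => B (take i p) l end.
pose phi p := corner (G p) (size p).-1.
have phiE p : seq_map phi p = mkseq (corner (G p)) (size p).
  apply: eq_in_mkseq => j jp; rewrite /phi size_takel//= /corner; congr choice.pickle.
  apply: eq_in_mkseq => i ij; apply: eq_in_mkseq => l lj.
  case: i ij => [|[|i]] //= ij; first by rewrite nth_take.
  by rewrite take_takel//; exact/ltnW/ltnW/ltnW.
apply: (@rank_le_of_map _ _ _ _ [::] phi rkP rkTP) => p Wp /=.
rewrite phiE /km_tree /= size_mkseq => i ip.
have GE k l : (k < size p)%N -> (l < size p)%N ->
    uncorner (nth 0%N (mkseq (corner (G p)) (size p))) k l = G p k l.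
  by move=> kp lp; apply: uncornerE; rewrite nth_mkseq// gtn_max kp.
have p0 : (0 < size p)%N by exact: leq_trans ip.
have p1 : (1 < size p)%N by exact: leq_trans ip.
have ip' : (i <= size p)%N by exact/ltnW/ltnW/ltnW.
exists a, (B (take i p)); split.
- by move=> l lp; rewrite GE.
- by move=> l lp; rewrite GE.
rewrite (_ : mkseq _ i = take i p); first exact/FB/(tree_take _ (tW a) Wp).
apply: (@eq_from_nth _ 0%N); first by rewrite size_mkseq size_takel.
move=> l; rewrite size_mkseq => li; rewrite nth_mkseq// nth_take// GE//.
exact: leq_trans li ip'.
Qed.

(** * Analytic sets and co-analytic ranks *)

Lemma measurable_preimageT d d' (T : measurableType d) (T' : measurableType d')
    (f : T -> T') (A : set T') :
  measurable_fun setT f -> measurable A -> measurable (f @^-1` A).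
Proof. by move=> mf mA; rewrite -[X in measurable X]setTI; exact: mf. Qed.

Lemma measurable_forall d (T : measurableType d) (J : countType) (P : J -> set T) :
  (forall i, measurable (P i)) -> measurable [set x | forall i, P i x].
Proof.
move=> mP; rewrite [X in measurable X](_ : _ = \bigcap_n
    (if choice.unpickle n is Some j then P j else setT)).
  by apply: bigcapT_measurable => n; case: choice.unpickle.
apply/seteqP; split=> x /= Px => [n _|i]; first by case: choice.unpickle.
by have := Px (choice.pickle i) I; rewrite choice.pickleK.
Qed.

Lemma measurable_imply d (T : measurableType d) (Q : Prop) (P : set T) :
  measurable P -> measurable [set x | Q -> P x].
Proof.
move=> mP; have [q|nq] := pselect Q.
  by rewrite (_ : [set x | Q -> P x] = P)//; apply/seteqP; split=> x /=; [apply|].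
by rewrite (_ : [set x | Q -> P x] = setT)//; apply/seteqP; split=> x /=.
Qed.

Lemma measurable_exists d (T : measurableType d) (J : countType) (P : J -> set T) :
  (forall i, measurable (P i)) -> measurable [set x | exists i, P i x].
Proof.
move=> mP; rewrite [X in measurable X](_ : _ = \bigcup_n
    (if choice.unpickle n is Some j then P j else set0)).
  by apply: bigcupT_measurable => n; case: choice.unpickle.
apply/seteqP; split=> x /= [i].
  by exists (choice.pickle i) => //; rewrite choice.pickleK.
by move=> _; case: choice.unpickle => // j Pj; exists j.
Qed.

Lemma measurable_agree (P : set baire) n :
  (forall a a', agree n a a' -> P a -> P a') -> measurable P.
Proof.
move=> nP; apply: sub_sigma_algebra; apply/baire_openP => a Pa.
by exists n => a' aa'; exact: nP Pa.
Qed.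

Lemma agree_comp (s : nat -> nat) n : exists m, forall a a',
  agree m a a' -> agree n (a \o s) (a' \o s).
Proof.
exists (\max_(i < n) (s i).+1)%N => a a' aa' i ni; apply: aa'.
exact: (@leq_bigmax _ (fun j : 'I_n => (s j).+1) (Ordinal ni)).
Qed.

Lemma measurable_baire_comp (s : nat -> nat) :
  measurable_fun [set: baire] (fun a : baire => (a \o s : baire)).
Proof.
have := @measurability _ _ baire baire setT (fun a => a \o s)
  (@open {ptws nat -> nat}); apply=> // _ [U oU <-]; rewrite setTI.
apply: sub_sigma_algebra; apply/baire_openP => a.
move=> /((baire_openP _).1 oU)[n nU]; have [m mn] := agree_comp s n.
by exists m => a' aa'; apply: nU; exact: mn.
Qed.

Section analytic_proj.
Variables (d : measure_display) (T : measurableType d) (g : baire -> T).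
Hypotheses (mg : measurable_fun setT g) (gT : forall x, exists a, g a = x).

(** The even entries of a point of the Baire space code a point of [T] through [g], the odd entries
    a witness. The pairs in [M] form a Borel set of codes, on which the first component parametrizes
    the projection. *)
Lemma analytic_proj (M : set (T * baire)) : measurable M ->
  analytic [set x | exists a, M (x, a)].
Proof.
move=> mM; pose ev (a : baire) : baire := a \o double.
pose od (a : baire) : baire := a \o (fun n => n.*2.+1).
have mh : measurable_fun setT (fun a => (g (ev a), od a)).
  apply: measurable_fun_pair; last exact: measurable_baire_comp.
  exact: (measurableT_comp mg (measurable_baire_comp _)).
have mE := measurable_preimageT mh mM.
have joinP a b : exists c, ev c = a /\ od c = b.
  exists (fun n => if odd n then b n./2 else a n./2).
  by split; apply/funext => n; rewrite /ev /od /= odd_double ?doubleK//= uphalf_double.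
have [[b0 Mb0]|nM] := pselect ((fun a => (g (ev a), od a)) @^-1` M !=set0); last first.
  left; apply/seteqP; split=> // x [a Ma]; apply: nM.
  have [b gb] := gT x; have [c [cb ca]] := joinP b a.
  by exists c => /=; rewrite cb ca gb.
(* Codes outside [M] are sent to a fixed point of the projection. *)
right; exists (fun a => if a \in (fun a => (g (ev a), od a)) @^-1` M
  then g (ev a) else g (ev b0)).
  apply: measurable_fun_ifT => //; last first.
    exact: (measurableT_comp mg (measurable_baire_comp _)).
  apply: (@measurable_fun_bool _ _ _ _ true); rewrite setTI.
  rewrite [X in measurable X](_ : _ = (fun a => (g (ev a), od a)) @^-1` M)//.
  by apply/seteqP; split=> a; [exact: set_mem|exact: mem_set].
apply/seteqP; split=> [x [a Ma]|x [c _ <-]] /=.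
  have [b gb] := gT x; have [c [cb ca]] := joinP b a.
  by exists c => //; rewrite mem_set /= cb// ca gb.
case: ifPn => [|_]; first by move=> /set_mem/= Mc; exists (od c).
by exists (od b0).
Qed.

End analytic_proj.
Definition determined (S : Type) (f : (nat -> nat) -> S) : Prop :=
  exists n, forall a a', agree n a a' -> f a = f a'.

Lemma determined_mkseq n : determined (fun a => mkseq a n).
Proof. by exists n => a a' aa'; exact: eq_in_mkseq. Qed.

Lemma determined_tree_map p : determined (fun a => tree_map a p).
Proof.
have [m mP] := agree_comp (fun j => choice.pickle (take j.+1 p)) (size p).
by exists m => a a' /mP aa'; apply: eq_in_mkseq => j jp; exact: aa'.
Qed.

Lemma determined_cons i (f : (nat -> nat) -> seq nat) :
  determined f -> determined (fun a => a i :: f a).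
Proof.
move=> [n nf]; exists (maxn i.+1 n) => a a' aa'; congr cons.
  by apply: aa'; rewrite leq_maxl.
by apply/nf/agree_le/aa'; rewrite leq_maxr.
Qed.

Section tree_ranks.
Variables (d : measure_display) (T : measurableType d) (g : baire -> T).
Hypotheses (mg : measurable_fun setT g) (gT : forall x, exists a, g a = x).
Variable W : T -> set (seq nat).
Hypotheses (tW : forall x, is_tree (W x))
  (mW : forall p, measurable [set x | W x p]).

(** The node [f (k z)] takes countably many values, each on a measurable set since finitely many
    coordinates decide it. *)
Lemma measurable_tree_eval d' (T' : measurableType d') (h : T' -> T)
    (k : T' -> baire) (f : (nat -> nat) -> seq nat) :
  measurable_fun setT h -> measurable_fun setT k -> determined f ->
  measurable [set z | W (h z) (f (k z))].
Proof.
move=> mh mk [n nf]; rewrite [X in measurable X](_ : _ =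
    [set z | exists q, (k @^-1` [set a | f a = q] `&` h @^-1` [set x | W x q]) z]).
  apply: measurable_exists => q; apply: measurableI; last exact: measurable_preimageT.
  apply: measurable_preimageT => //; apply: (@measurable_agree _ n).
  by move=> a a' /nf /= ->.
by apply/seteqP; split=> z /= => [Wz|[q [<-]]//]; exists (f (k z)).
Qed.

Lemma coanalytic_wf_tree : coanalytic [set x | wf_tree (W x)].
Proof.
rewrite /coanalytic [X in analytic X](_ : _ =
    [set x | exists a : baire, [set z : T * baire | forall n, W z.1 (mkseq z.2 n)] (x, a)]).
  apply: (analytic_proj mg gT); apply: measurable_forall => n.
  exact: (measurable_tree_eval measurable_fst measurable_snd (determined_mkseq n)).
by apply/seteqP; split=> x /=; rewrite /wf_tree; [move/contrapT|move=> h; apply].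
Qed.

Lemma surjection_pair : exists2 h : baire -> T * T, measurable_fun setT h &
  forall z, exists a, h a = z.
Proof.
exists (fun a => (g (a \o double), g (a \o (fun n => n.*2.+1)))).
  by apply: measurable_fun_pair; exact: (measurableT_comp mg (measurable_baire_comp _)).
move=> [x y]; have [[a <-] [b <-]] := (gT x, gT y).
exists (fun n => if odd n then b n./2 else a n./2); congr (g _, g _);
  by apply/funext => n; rewrite /= odd_double ?doubleK//= uphalf_double.
Qed.

Lemma analytic_tree_map (f1 f2 : T * T -> T) (F : seq nat -> (nat -> nat) -> seq nat) :
  measurable_fun setT f1 -> measurable_fun setT f2 ->
  (forall p, determined (F p)) ->
  analytic [set z | exists a, forall p, W (f1 z) p -> W (f2 z) (F p a)].
Proof.
move=> mf1 mf2 dF; have [h mh hT] := surjection_pair.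
have := @analytic_proj _ _ h mh hT
  [set z | forall p, W (f1 z.1) p -> W (f2 z.1) (F p z.2)]; apply.
apply: measurable_forall => p.
rewrite [X in measurable X](_ : _ = (~` [set z : T * T * baire | W (f1 z.1) p]) `|`
    [set z | W (f2 z.1) (F p z.2)]).
  apply: measurableU; last first.
    by apply: measurable_tree_eval => //; exact: (measurableT_comp mf2 measurable_fst).
  apply: measurableC; apply: (@measurable_preimageT _ _ _ _ (f1 \o fst) [set x | W x p]) => //.
  exact: (measurableT_comp mf1 measurable_fst).
apply/seteqP; split=> z /=.
  by move=> WW; have [Wp|nWp] := pselect (W (f1 z.1) p); [right; exact: WW|left].
by move=> [].
Qed.

Lemma coanalytic_rank_tree_rank (R : realType) : standard_borel T R ->
  coanalytic_rank R (fun x : [set x | wf_tree (W x)] => tree_rank (W (\val x))).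
Proof.
move=> sT; split=> //; first exact: coanalytic_wf_tree.
exists [set z | exists a, tree_le (W z.1) (W z.2) a].
(* When the second tree is well founded, being below it is the negation of a strict map in the other
   direction; this gives the co-analytic description. *)
exists (~` [set z | exists a, tree_lt (W z.2) (W z.1) a]); split.
- exact: (analytic_tree_map measurable_fst measurable_snd determined_tree_map).
- rewrite /coanalytic setCK.
  apply: (analytic_tree_map measurable_snd measurable_fst) => p.
  exact/determined_cons/determined_tree_map.
move=> [y /= /set_mem yB] x; split.
  rewrite -tree_leP//; split=> [[[x' x'B] /= <- rle]|[xB rle]].
    by split=> //; have /= := set_mem x'B.
  by exists (exist _ x (mem_set xB)).
rewrite -tree_leP// -tree_ltP//; split=> [h|/contrapT//].
by apply.
Qed.

Lemma tree_rank_analytic_bounded (A : set T) : analytic A ->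
  A `<=` [set x | wf_tree (W x)] ->
  exists xi, forall x, A x -> (tree_rank (W x) <= xi)%O.
Proof.
move=> [->|[f mf ->]] AB; first by exists point.
have [|a||xi xiP] := @tree_rank_bounded (fun a => W (f a)); last 1 first.
- by exists xi => x [a _ <-].
- by [].
- by apply: AB; exists a.
- move=> p; apply: souslin_measurable.
  exact: (measurable_preimageT mf (mW p)).
Qed.

End tree_ranks.

(** * Polish spaces *)

Section eps.
Variable R : realType.

Definition eps (j : nat) : R := j.+1%:R^-1.

Lemma eps_gt0 j : 0 < eps j. Proof. by rewrite invr_gt0. Qed.

Lemma eps_ge0 j : 0 <= eps j. Proof. exact/ltW/eps_gt0. Qed.

Lemma eps_le j k : (j <= k)%N -> eps k <= eps j.
Proof. by move=> jk; rewrite lef_pV2 ?posrE// ler_nat. Qed.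

Lemma eps_lt (r : R) : 0 < r -> exists j, eps j < r.
Proof.
move=> r0; have [j] := ltr_add_invr (r0 : 0 < r); rewrite add0r => jr.
by exists j.
Qed.

Lemma cvg_eps : eps @ \oo --> (0 : R).
Proof. exact: cvg_harmonic. Qed.

End eps.

Arguments eps {R}.
Arguments eps_gt0 {R}.
Arguments eps_ge0 {R}.
Arguments eps_le {R j k}.

Lemma dense_seq (R : realType) (P : pseudoPMetricType R) : separable P ->
  exists p : nat -> P, forall x (e : R), 0 < e -> exists n, ball x e (p n).
Proof.
move=> [D /countable_injP[f finj] dD].
have /choice[p pP] : forall n, exists x, forall y, D y -> f y = n -> x = y.
  move=> n; have [[y [Dy fy]]|h] := pselect (exists y, D y /\ f y = n).
    exists y => z Dz fz; apply: finj; [exact: mem_set|exact: mem_set|].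
    by rewrite fy.
  by exists point => y Dy fy; case: h; exists y.
exists p => x e e0; have [y [xy Dy]] := dD (interior (ball x e))
  (ex_intro _ x (nbhsx_ballx x e e0)) (open_interior _).
by exists (f y); rewrite (pP _ y)//; exact: interior_subset.
Qed.

Section polish_surjection.
Variables (R : realType) (P : completePseudoMetricType R).
Hypotheses (hP : hausdorff_space P) (sP : separable P).

Lemma polish_surjection : exists g : baire -> P,
  (forall U, open U -> measurable (g @^-1` U)) /\ forall x, exists a, g a = x.
Proof.
have [p pP] := dense_seq sP.
(* All pairs are compared, not only consecutive terms, so the non-summable [eps] still controls the
   distance to the limit. *)
pose C : set baire := [set a | forall j k, (j <= k)%N ->
  ball (p (a j)) (eps j) (p (a k))].
have Ccvg a : C a -> cvg ((p \o a) @ \oo).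
  move=> Ca; apply/cauchy_cvgP/cauchy_exP => e /eps_lt[j je].
  exists (p (a j)); exists j => // k /= jk.
  exact: le_ball (ltW je) _ (Ca _ _ jk).
pose g a := if a \in C then lim ((p \o a) @ \oo) else p 0%N.
have gC a j : C a -> ball (g a) (2 * eps j) (p (a j)).
  move=> Ca; rewrite /g mem_set//.
  have /cvg_ball/(_ _ (eps_gt0 j))[k _ kP] := Ccvg a Ca.
  rewrite mulr_natl mulr2n; apply: (@ball_triangle _ _ (p (a (maxn j k)))).
    by apply: kP => /=; rewrite leq_maxr.
  by apply: ball_sym; apply: Ca; rewrite leq_maxl.
exists g; split=> [U oU|x].
(* On [C], the limit lies in an open set iff some approximation [p (a j)] has its ball of radius
   [2 * eps j] inside that set, a condition on finitely many entries. *)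
- rewrite [X in measurable X](_ : _ = (C `&` [set a : baire |
      exists j, ball (p (a j)) (2 * eps j) `<=` U]) `|` (~` C `&` [set a | U (p 0%N)])).
    have mC : measurable C.
      apply: measurable_forall => j; apply: measurable_forall => k.
      apply: (@measurable_agree _ (maxn j k).+1) => a a' aa'.
      by rewrite !aa'// ltnS ?leq_maxl ?leq_maxr.
    apply: measurableU; apply: measurableI => //.
    + apply: measurable_exists => j; apply: (@measurable_agree _ j.+1) => a a' aa'.
      by rewrite aa'.
    + exact: measurableC.
    + by apply: (@measurable_agree _ 0%N) => a a'.
  apply/seteqP; split=> a /=.
    have [Ca Ug|nCa] := pselect (C a); last first.
      by rewrite /g ifF ?memNset// => ?; right.
    left; split=> //; have [e e0 eU] := (nbhs_ballP _ _).1 (open_nbhs_nbhs (conj oU Ug)).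
    have [|j je] := eps_lt (_ : 0 < e / 4); first by rewrite divr_gt0.
    exists j => y yj; apply: eU; apply: (@le_ball _ _ _ (2 * eps j + 2 * eps j)).
      by rewrite -mulrDl -natrD mulrC -ler_pdivlMr// ltW.
    exact: ball_triangle (gC _ j Ca) yj.
  move=> [[Ca [j jU]]|[nCa]]; last by rewrite /g ifF// memNset.
  by apply: jU; apply: ball_sym; exact: gC.
- have /choice[a aP] : forall j, exists n, ball x (eps j / 2) (p n).
    by move=> j; apply: pP; rewrite divr_gt0// eps_gt0.
  have Ca : C a.
    move=> j k jk; apply: (@ball_splitr _ _ x); first exact: aP.
    apply: le_ball (aP k); rewrite ler_pM2r//; exact: eps_le.
  exists a; rewrite /g mem_set//; apply: cvg_lim => //.
  apply/cvg_ballP => e /eps_lt[j je]; exists j => // k /= jk.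
  apply: le_ball (aP k); rewrite (le_trans _ (ltW je))// (le_trans _ (eps_le jk))//.
  by rewrite ler_pdivrMr// ler_peMr ?eps_ge0// ler1n.
Qed.

End polish_surjection.

Lemma standard_borel_surjection (R : realType) d (T : measurableType d) :
  standard_borel T R -> exists g : baire -> T,
    measurable_fun setT g /\ forall x, exists a, g a = x.
Proof.
move=> [P [f [hP sP [f' fK f'K] mT]]].
have [g [mg gT]] := polish_surjection hP sP.
exists (f' \o g); split=> [_ A|x]; last first.
  by have [a ga] := gT (f x); exists a; rewrite /= ga fK.
rewrite mT => -[B sB <-]; rewrite setTI.
rewrite [X in measurable X](_ : _ = g @^-1` B); last first.
  by apply/seteqP; split=> a /=; rewrite f'K.
have : [set B | measurable (g @^-1` B)] B; last by [].
apply: smallest_sub sB => //; split=> /=.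
- by rewrite preimage_set0.
- by move=> D mD; rewrite setTD preimage_setC; exact: measurableC.
- by move=> D mD; rewrite preimage_bigcup; exact: bigcupT_measurable.
Qed.

(** * The space of operators is standard Borel *)

Section operators_polish.
Variables (R : realType) (X Y : completeNormedModType R) (d : nat -> X).
Hypothesis dX : forall x (e : R), 0 < e -> exists n, ball x e (d n).
Hypothesis X0 : exists x : X, x != 0.

Local Notation L := (operators X Y).

Definition ap (T : L) : X -> Y := \val T.

Definition bounded_on_seq (T : X -> Y) (c : R) : Prop :=
  forall i, `|T (d i)| <= c * `|d i|.

Lemma ap_linear (T : L) : linear (ap T).
Proof. by have [] := set_mem (valP T). Qed.

Lemma ap_bounded (T : L) : exists M : R, forall x, `|ap T x| <= M * `|x|.
Proof. by have [] := set_mem (valP T). Qed.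

Lemma apB (T : L) x y : ap T (x - y) = ap T x - ap T y.
Proof. by rewrite addrC -scaleN1r ap_linear scaleN1r addrC. Qed.

Lemma apZ (T : operators X Y) c x : ap T (c *: x) = c *: ap T x.
Proof.
have T0 : ap T 0 = 0 by rewrite -(subrr x) apB subrr.
by rewrite -[c *: x]addr0 ap_linear T0 addr0.
Qed.

Lemma ap_bounded_on (T : L) c : 0 <= c -> bounded_on_seq (ap T) c ->
  forall x, `|ap T x| <= c * `|x|.
Proof.
move=> c0 Tc x; have [M MP] := ap_bounded T.
apply/ler_addgt0Pr => e e0.
(* The errors [|M| * (e / K)] and [c * (e / K)] add up to at most [e]; the summand 1 keeps [K]
   positive. *)
pose K := `|M| + c + 1.
have K0 : 0 < K by rewrite ltr_wpDl// addr_ge0.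
have [|n xn] := dX x (_ : 0 < e / K); first by rewrite divr_gt0.
move: xn; rewrite -ball_normE /= => xn.
have -> : ap T x = ap T (x - d n) + ap T (d n) by rewrite apB subrK.
apply: (le_trans (ler_normD _ _)).
have h1 : `|ap T (x - d n)| <= `|M| * (e / K).
  apply: (le_trans (MP _)); apply: (@le_trans _ _ (`|M| * `|x - d n|)).
    by rewrite ler_wpM2r// ler_norm.
  by rewrite ler_wpM2l// ltW.
have h2 : `|ap T (d n)| <= c * `|x| + c * (e / K).
  apply: (le_trans (Tc n)); rewrite -mulrDr ler_wpM2l//.
  have {1}-> : d n = x - (x - d n) by rewrite opprB addrCA subrr addr0.
  by apply: (le_trans (ler_normB _ _)); rewrite lerD2l ltW.
apply: (le_trans (lerD h1 h2)); rewrite addrCA lerD2l -mulrDl.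
by rewrite mulrA ler_pdivrMr// mulrC ler_wpM2l ?(ltW e0)// /K lerDl.
Qed.

Lemma op_bound_ex (T : L) : exists n, `[< bounded_on_seq (ap T) n%:R >].
Proof.
have [M MP] := ap_bounded T; exists (Num.bound `|M|); apply/asboolP => i.
apply: (le_trans (MP _)); rewrite ler_wpM2r//.
by apply: (le_trans (ler_norm M)); exact/ltW/archi_boundP.
Qed.

Definition op_bound (T : L) : nat := ex_minn (op_bound_ex T).

(** Positive iff [d k] witnesses that [n - 1] is not a bound for [T]. The subtraction is in [R], so
    that [n = 0] is covered. *)
Definition gap (T : X -> Y) (n k : nat) : R := `|T (d k)| - (n%:R - 1) * `|d k|.

Lemma d_neq0 : exists k, d k != 0.
Proof.
have [x x0] := X0; have [|k xk] := dX x (_ : 0 < `|x|); first by rewrite normr_gt0.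
exists k; apply/eqP => dk; move: xk.
by rewrite dk -ball_normE /= subr0 ltxx.
Qed.

Lemma op_witness_ex (T : L) : exists k, 0 < gap (ap T) (op_bound T) k.
Proof.
apply: contrapT => /forallNP nk.
have Tb : bounded_on_seq (ap T) ((op_bound T)%:R - 1).
  by move=> i; have /negP := nk i; rewrite -leNgt subr_le0.
(* If the least bound is 0, then -1 would be a bound too, which a nonzero [d k] refutes. *)
move: Tb; rewrite /op_bound; case: ex_minnP => -[|n] _ nmin Tb.
  have [k dk] := d_neq0; have := Tb k.
  rewrite sub0r mulN1r => /(le_trans (normr_ge0 _)).
  by rewrite oppr_ge0 normr_le0 (negbTE dk).
have := nmin n; rewrite ltnn => h; suff : false by []; apply: h; apply/asboolP => i.
by rewrite -[n%:R](addrK 1) -natr1 in Tb *; exact: Tb.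
Qed.

Definition op_witness (T : L) : nat := ex_minn (op_witness_ex T).

Definition op_height (T : L) : R := (gap (ap T) (op_bound T) (op_witness T))^-1.

(** The pair of least bound and first witness, expressed by inequalities between evaluations of [T],
    so that its Borel measurability is visible. *)
Definition level (n k : nat) (T : L) : Prop :=
  [/\ bounded_on_seq (ap T) n%:R, 0 < gap (ap T) n k &
      forall i, (i < k)%N -> gap (ap T) n i <= 0].

Lemma levelP n k T : level n k T <-> op_bound T = n /\ op_witness T = k.
Proof.
split=> [[Tn gk gi]|[<- <-]].
  have bn : op_bound T = n.
    rewrite /op_bound; case: ex_minnP => m /asboolP Tm mmin.
    apply/eqP; rewrite eqn_leq mmin ?andbT; last exact/asboolP.
    rewrite leqNgt; apply/negP => mn; move: gk; rewrite ltNge => /negP; apply.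
    rewrite subr_le0; apply: (le_trans (Tm k)); rewrite ler_wpM2r//.
    by rewrite lerBrDr natr1 ler_nat.
  split=> //; rewrite /op_witness; case: ex_minnP; rewrite bn => m gm mmin.
  apply/eqP; rewrite eqn_leq mmin//= leqNgt; apply/negP => /gi.
  by rewrite leNgt gm.
split.
- by rewrite /op_bound; case: ex_minnP => m /asboolP.
- by rewrite /op_witness; case: ex_minnP.
move=> i; rewrite /op_witness; case: ex_minnP => m gm mmin im.
by rewrite leNgt; apply/negP => /mmin; rewrite leqNgt im.
Qed.

Lemma op_height_gt0 T : 0 < op_height T.
Proof. by have [_ + _] := (levelP _ _ T).2 (conj erefl erefl); rewrite invr_gt0. Qed.

(* Operators at a small distance have the same least integer bound [n] on their
   norm and the same first witness that [n - 1] is not such a bound. The latter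
   is an open condition on [T]: the inverse [op_height] of the gap blows up at
   its boundary, which makes the metric complete. *)
Definition op_ball (T : L) (e : R) (S : L) : Prop :=
  [/\ e <= 1 -> op_bound T = op_bound S /\ op_witness T = op_witness S,
      forall i, i.+1%:R * e < 1 -> `|ap T (d i) - ap S (d i)| < e &
      `|op_height T - op_height S| < e].

Lemma op_ball_center T e : 0 < e -> op_ball T e T.
Proof. by move=> e0; split=> // [i|]; rewrite subrr normr0. Qed.

Lemma op_ball_sym T S e : op_ball T e S -> op_ball S e T.
Proof.
move=> [h1 h2 h3]; split=> [/h1[]//|i /h2|]; rewrite distrC//.
Qed.

Lemma op_ball_gt0 T S e : op_ball T e S -> 0 < e.
Proof. by move=> [_ _]; exact: le_lt_trans. Qed.

(** The thresholds [e <= 1] and [i.+1%:R * e < 1] get harder as [e] grows: whatever radius [e1 + e2]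
    tests, [e1] and [e2] test as well. *)
Lemma op_ball_triangle T S U e1 e2 :
  op_ball T e1 S -> op_ball S e2 U -> op_ball T (e1 + e2) U.
Proof.
move=> TS SU; have [e10 e20] := (op_ball_gt0 TS, op_ball_gt0 SU).
move: TS SU => [h1 h2 h3] [k1 k2 k3]; split=> [e1e2|i ie|].
- have [|-> ->] := h1; first by apply: le_trans e1e2; rewrite lerDl ltW.
  by apply: k1; apply: le_trans e1e2; rewrite lerDr ltW.
- rewrite -(subrKA (ap S (d i))); apply: (le_lt_trans (ler_normD _ _)); apply: ltrD.
    by apply: h2; apply: le_lt_trans ie; rewrite ler_pM2l// lerDl ltW.
  by apply: k2; apply: le_lt_trans ie; rewrite ler_pM2l// lerDr ltW.
- rewrite -(subrKA (op_height S)); apply: (le_lt_trans (ler_normD _ _)).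
  exact: ltrD.
Qed.

End operators_polish.

(* The set of operators with the Polish topology of [op_ball], finer than the
   strong operator topology. *)
Definition polish_operators (R : realType) (X Y : completeNormedModType R)
  (d : nat -> X) of (forall x (e : R), 0 < e -> exists n, ball x e (d n)) &
  (exists x : X, x != 0) : Type := operators X Y.

Section polish_operators_metric.
Variables (R : realType) (X Y : completeNormedModType R) (d : nat -> X).
Hypothesis dX : forall x (e : R), 0 < e -> exists n, ball x e (d n).
Hypothesis X0 : exists x : X, x != 0.

Local Notation P := (polish_operators Y dX X0).
Local Notation pball := (op_ball dX X0 : P -> R -> P -> Prop).

HB.instance Definition _ := Pointed.copy P (operators X Y).

HB.instance Definition _ := hasNbhs.Build P (nbhs_ball_ pball).

Lemma polish_operators_nbhsE :
  (@nbhs P P) = nbhs_ (entourage_ pball).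
Proof.
rewrite predeq2E => T A; split=> [[e e0 eA]|[E [e e0 eE] EA]].
  exists [set xy | pball xy.1 e xy.2]; first by exists e.
  by move=> S /xsectionP; exact: eA.
by exists e => // S eS; apply/EA/xsectionP/eE.
Qed.

HB.instance Definition _ := @Nbhs_isPseudoMetric.Build R P
  (entourage_ pball) polish_operators_nbhsE pball
  (@op_ball_center _ _ _ _ dX X0) (@op_ball_sym _ _ _ _ dX X0)
  (@op_ball_triangle _ _ _ _ dX X0) erefl.

Lemma op_bound_le (T : P) x : `|ap T x| <= (op_bound d T)%:R * `|x|.
Proof.
by apply: (ap_bounded_on dX) => //; have [] := (levelP dX X0 _ _ T).2 (conj erefl erefl).
Qed.

(** Nearby operators share the bound [m], so their values at [x] are controlled by those at a close
    [d n]. *)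
Lemma ap_ball_lt (m : nat) x (e : R) : 0 < e ->
  exists2 e', 0 < e' & forall T S : P, op_bound d T = m -> ball T e' S ->
    `|ap T x - ap S x| < e.
Proof.
move=> e0; pose N : R := m%:R + 1.
have N0 : 0 < N by rewrite ltr_wpDl.
have [|n] := dX x (_ : 0 < e / (3 * N)); first by rewrite divr_gt0// mulr_gt0.
rewrite -ball_normE /= => xn.
(* A radius at most [n.+2%:R^-1] makes the ball test coordinate [n] and fixes the bound; [e / 3] is
   the share of that coordinate. *)
exists (Num.min (n.+2%:R^-1) (e / 3)).
  by rewrite lt_min invr_gt0 ltr0n /= divr_gt0.
move=> T S bT [h1 h2 _].
have [|bTS _] := h1.
  by rewrite ge_min invf_le1 ?ltr0n// ler1n.
have {}h2 : `|ap T (d n) - ap S (d n)| < e / 3.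
  apply: lt_le_trans (h2 n _) _; last by rewrite ge_min lexx orbT.
  apply: (@le_lt_trans _ _ (n.+1%:R * n.+2%:R^-1)).
    by rewrite ler_pM2l ?ltr0n// ge_min lexx.
  by rewrite ltr_pdivrMr ?ltr0n// mul1r ltr_nat.
have small (U : P) : op_bound d U = m -> `|ap U x - ap U (d n)| < e / 3.
  move=> UT; rewrite -apB; apply: (le_lt_trans (op_bound_le _ _)); rewrite UT.
  apply: (@le_lt_trans _ _ (N * `|x - d n|)); first by rewrite ler_wpM2r// lerDl.
  by rewrite -ltr_pdivlMl// mulrC -mulrA -invfM.
rewrite -(subrKA (ap T (d n))) -(subrKA (ap S (d n)) (ap T (d n))).
apply: (le_lt_trans (ler_normD _ _)).
have -> : e = e / 3 + (e / 3 + e / 3) by field.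
apply: ltrD; first exact: small.
apply: (le_lt_trans (ler_normD _ _)); apply: ltrD => //.
by rewrite distrC; apply: small; rewrite -bTS.
Qed.

Lemma sot_open_polish (U : set (operators X Y)) : open U -> open (U : set P).
Proof.
move=> [V oV <-]; rewrite openE => T VT; apply/nbhs_ballP.
have : {ptws, (fun S : P => ap S) @ nbhs T --> ap T}.
  apply/pointwise_cvgP => x; apply/cvgrPdist_lt => e /(@ap_ball_lt (op_bound d T) x)[e' e'0 e'P].
  by apply/nbhs_ballP; exists e' => // S; exact: e'P.
move=> /(_ V)[|e e0 eV]; first exact: open_nbhs_nbhs.
by exists e.
Qed.


Lemma polish_operators_hausdorff : hausdorff_space P.
Proof.
move=> T S TS; apply/val_inj/funext => x; apply/eqP; rewrite -subr_eq0 -normr_le0.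
apply/ler_addgt0Pr => e e0; rewrite add0r.
have [|e1 e10 e1P] := @ap_ball_lt (op_bound d T) x (e / 2); first by rewrite divr_gt0.
have [|e2 e20 e2P] := @ap_ball_lt (op_bound d S) x (e / 2); first by rewrite divr_gt0.
have [U [TU SU]] := TS _ _ (nbhsx_ballx T e1 e10) (nbhsx_ballx S e2 e20).
rewrite -[X in `|X|](subrKA (ap U x)) (splitr e).
apply: (le_trans (ler_normD _ _)); apply: lerD; first exact/ltW/e1P.
by rewrite distrC; exact/ltW/e2P.
Qed.

Section limit.
Variables (F : set_system P) (FF : ProperFilter F) (cF : cauchy F).

Let cauchy_set (e : R) : 0 < e ->
  exists2 A, F A & forall S S', A S -> A S' -> ball S e S'.
Proof.
move=> e0; have [[A B] [FA FB] AB] := (cauchy_ballP F).2 cF e e0.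
exists (A `&` B); first exact: filterI.
by move=> S S' [AS _] [_ BS']; exact: (AB (S, S')).
Qed.

Lemma polish_operators_cvg : cvg F.
Proof.
have [A1 FA1 A1P] := cauchy_set ltr01.
have [S1 AS1] := filter_ex FA1.
pose n := op_bound d S1; pose k := op_witness dX X0 S1.
have lev S : A1 S -> op_bound d S = n /\ op_witness dX X0 S = k.
  by move=> AS; have [+ _ _] := A1P _ _ AS1 AS => /(_ (lexx _))[<- <-].
have cY x : cvg ((fun S : P => ap S x) @ F).
  apply/cauchy_cvgP/cauchy_exP => e e0.
  have [e' e'0 e'P] := @ap_ball_lt n x e e0.
  have [A2 FA2 A2P] := cauchy_set e'0.
  have [S2 [AS2 A1S2]] := filter_ex (filterI FA2 FA1).
  exists (ap S2 x); suff : F [set S | ball (ap S2 x) e (ap S x)] by [].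
  apply: filterS FA2 => S AS.
  by rewrite /= -ball_normE /=; apply: e'P; [have [] := lev _ A1S2|exact: A2P].
pose T x := lim ((fun S : P => ap S x) @ F).
have cT x : (fun S : P => ap S x) @ F --> T x by exact: cY.
have Tn x : `|T x| <= n%:R * `|x|.
  apply: (@cvgr_to_le _ F _ R (fun S : P => `|ap S x|)).
    by apply: cvg_norm; exact: cT.
  by apply: filterS FA1 => S AS; rewrite -(lev _ AS).1; exact: op_bound_le.
have linT : linear T.
  move=> a u v; apply: (@cvg_unique _ (@norm_hausdorff _ Y) ((fun S : P => ap S (a *: u + v)) @ F)).
    exact: cT.
  rewrite (_ : (fun S : P => ap S (a *: u + v)) = fun S => a *: ap S u + ap S v).
    by apply: cvgD; [apply: cvgZr|]; exact: cT.
  by apply/funext => S; exact: ap_linear.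
have Top : T \in operators X Y by apply/mem_set; split=> //; exists n%:R.
pose T' : P := exist _ (T : {ptws X -> Y}) Top.
have cH : cvg ((fun S : P => op_height dX X0 S) @ F).
  apply/cauchy_cvgP/cauchy_exP => e e0.
  have [A2 FA2 A2P] := cauchy_set e0; have [S2 AS2] := filter_ex FA2.
  exists (op_height dX X0 S2).
  suff : F [set S | ball (op_height dX X0 S2) e (op_height dX X0 S)] by [].
  apply: filterS FA2 => S AS.
  by rewrite /= -ball_normE /=; have [] := A2P _ _ AS2 AS.
have cG i : (fun S : P => gap d (ap S) n i) @ F --> gap d T n i.
  apply: cvgB; last exact: cvg_cst.
  by apply: cvg_norm; exact: cT.
have Tlev : level d n k T' /\ op_height dX X0 T' = lim ((fun S : P => op_height dX X0 S) @ F).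
  (* Gap times height is 1 along the filter. In the limit the gap cannot vanish, so [k] is still a
     witness for [T]. *)
  have GH : gap d T n k * lim ((fun S : P => op_height dX X0 S) @ F) = 1.
    apply: (@cvg_unique _ (@norm_hausdorff _ R^o)
      ((fun S : P => gap d (ap S) n k * op_height dX X0 S) @ F)).
      by apply: cvgM; [exact: cG|exact: cH].
    apply: cvg_near_cst; apply: filterS FA1 => S /lev[bS wS].
    have [_ g0 _] := (levelP dX X0 _ _ S).2 (conj bS wS).
    by rewrite /op_height bS wS divff// gt_eqF.
  have l : level d n k T'.
    split=> [i||i ik]; first exact: Tn.
      rewrite lt_neqAle; apply/andP; split.
        by apply/eqP => g0; move: GH; rewrite -g0 mul0r => /eqP; rewrite eq_sym oner_eq0.
      apply: (@cvgr_to_ge _ F _ R _ _ _ (cG k)).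
      apply: filterS FA1 => S /lev/(levelP dX X0 _ _ S).2[_ g0 _]; exact: ltW.
    apply: (@cvgr_to_le _ F _ R _ _ _ (cG i)).
    by apply: filterS FA1 => S /lev/(levelP dX X0 _ _ S).2[_ _]; exact.
  split=> //; have [bT wT] := (levelP dX X0 _ _ T').1 l.
  rewrite /op_height bT wT; apply: (@mulfI _ (gap d T n k)).
    by apply/eqP => g0; move: GH; rewrite g0 mul0r => /eqP; rewrite eq_sym oner_eq0.
  rewrite GH divff//; by have [_ + _] := l => /gt_eqF ->.
have [l hT] := Tlev; have [bT wT] := (levelP dX X0 _ _ T').1 l.
apply/cvg_ex; exists T'; apply/cvg_ballP => e e0.
have e20 : 0 < e / 2 by rewrite divr_gt0.
have [A2 FA2 A2P] := cauchy_set e20.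
apply: filterS (filterI FA1 FA2) => S [AS A2S]; apply: op_ball_sym.
(* Limits give only weak inequalities; halving the radius restores the strict ones. *)
have e2e : e / 2 < e by rewrite ltr_pdivrMr// mulr_natr mulr2n ltrDl.
split.
- by move=> _; rewrite bT wT; exact: lev.
- move=> i ie; apply: le_lt_trans (e2e).
  apply: (@cvgr_to_le _ F _ R (fun S' : P => `|ap S (d i) - ap S' (d i)|)).
    by apply: cvg_norm; apply: cvgB; [exact: cvg_cst|exact: cT].
  apply: filterS FA2 => S' AS'; have [_ + _] := A2P _ _ A2S AS'.
  move=> /(_ i) h; apply/ltW/h; apply: le_lt_trans ie.
  by rewrite ler_pM2l ?ltr0n// ltW.
- rewrite hT; apply: le_lt_trans (e2e).
  apply: (@cvgr_to_le _ F _ R (fun S' : P => `|op_height dX X0 S - op_height dX X0 S'|)).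
    by apply: cvg_norm; apply: cvgB; [exact: cvg_cst|exact: cH].
  by apply: filterS FA2 => S' AS'; have [_ _ /ltW] := A2P _ _ A2S AS'.
Qed.

End limit.

HB.instance Definition _ := Uniform_isComplete.Build P polish_operators_cvg.

End polish_operators_metric.

Section continuous_functions.
Variables (R : realType) (V : normedModType R) (S : topologicalType).

Lemma continuous_normf (f : S -> V) : continuous f -> continuous (fun x => `|f x|).
Proof. by move=> cf x; apply: cvg_norm; exact: cf. Qed.

Lemma continuous_subf (f g : S -> V) :
  continuous f -> continuous g -> continuous (fun x => f x - g x).
Proof. by move=> cf cg x; apply: cvgB; [exact: cf|exact: cg]. Qed.

Lemma continuous_mulcf (c : R) (f : S -> R) :
  continuous f -> continuous (fun x => c * f x).
Proof. by move=> cf x; apply: cvgM; [exact: cvg_cst|exact: cf]. Qed.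

Lemma continuous_cstf (v : V) : continuous (fun _ : S => v).
Proof. by move=> x; exact: cvg_cst. Qed.

End continuous_functions.

(** * The Polish and the strong operator topology have the same Borel sets *)

Section operators_standard_borel.
Variables (R : realType) (X Y : completeNormedModType R).

Lemma ap_continuous x : continuous (fun T : operators X Y => ap T x).
Proof.
move=> T; have := @continuous_comp _ _ _ (fun T : operators X Y => \val T : {ptws X -> Y})
  (fun f : {ptws X -> Y} => f x) T; apply.
  exact: initial_continuous.
exact: ptws_eval_continuous.
Qed.

Lemma measurable_operators_gt0 (f : operators X Y -> R) : continuous f ->
  measurable [set T : opspace X Y | 0 < f T].
Proof.
move=> cf; apply: sub_sigma_algebra.
exact: ((continuousP f).1 cf _ (@open_gt R 0)).
Qed.

Lemma measurable_operators_le0 (f : operators X Y -> R) : continuous f ->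
  measurable [set T : opspace X Y | f T <= 0].
Proof.
move=> cf; rewrite [X in measurable X](_ : _ = ~` [set T : opspace X Y | 0 < f T]).
  by apply: measurableC; exact: measurable_operators_gt0.
by apply/seteqP; split=> T /=; rewrite leNgt => /negP.
Qed.

Lemma continuous_norm_ap x : continuous (fun T : operators X Y => `|ap T x|).
Proof. exact/continuous_normf/ap_continuous. Qed.

Variables (d : nat -> X) (e : nat -> Y).
Hypothesis dX : forall x (r : R), 0 < r -> exists n, ball x r (d n).
Hypothesis eY : forall y (r : R), 0 < r -> exists n, ball y r (e n).
Hypothesis X0 : exists x : X, x != 0.

Local Notation P := (polish_operators Y dX X0).

Lemma continuous_gap n k : continuous (fun T : operators X Y => gap d (ap T) n k).
Proof.
by apply: continuous_subf; [exact: continuous_norm_ap|exact: continuous_cstf].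
Qed.

Lemma measurable_level n k :
  measurable [set T : opspace X Y | level d n k (T : operators X Y)].
Proof.
rewrite [X in measurable X](_ : _ =
    [set T : opspace X Y | forall i, `|ap T (d i)| - n%:R * `|d i| <= 0] `&`
    ([set T : opspace X Y | 0 < gap d (ap T) n k] `&`
     [set T : opspace X Y | forall i, (i < k)%N -> gap d (ap T) n i <= 0])).
  apply: measurableI; last apply: measurableI.
  - apply: measurable_forall => i; apply: measurable_operators_le0.
    by apply: continuous_subf; [exact: continuous_norm_ap|exact: continuous_cstf].
  - by apply: measurable_operators_gt0; exact: continuous_gap.
  - apply: measurable_forall => i; apply: measurable_imply.
    by apply: measurable_operators_le0; exact: continuous_gap.
apply/seteqP; split=> T /=.
  by move=> [Tn g0 gi]; split=> // i; rewrite subr_le0; exact: Tn.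
by move=> [Tn [g0 gi]]; split=> // i; have := Tn i; rewrite subr_le0.
Qed.

(* A countable base of the Polish topology; the height is approximated by the
   fractions [t / m.+1]. *)
Definition op_base (c : nat * nat * nat * nat * seq nat) : set P :=
  let: (n, k, m, t, s) := c in
  [set T | [/\ level d n k T,
     forall i, (i < m)%N -> `|ap T (d i) - e (nth 0%N s i)| < m.+1%:R^-1 &
     `|op_height dX X0 T - t%:R / m.+1%:R| <= m.+1%:R^-1]].

Lemma measurable_op_base c : measurable (op_base c : set (opspace X Y)).
Proof.
case: c => [[[[n k] m] t] s] /=.
rewrite [X in measurable X](_ : _ = [set T : opspace X Y | level d n k (T : operators X Y)] `&`
    ([set T : opspace X Y | forall i, (i < m)%N ->
        0 < m.+1%:R^-1 - `|ap T (d i) - e (nth 0%N s i)|] `&`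
     [set T : opspace X Y | `|1 - t%:R / m.+1%:R * gap d (ap T) n k|
        - m.+1%:R^-1 * gap d (ap T) n k <= 0])).
  apply: measurableI; first exact: measurable_level.
  apply: measurableI.
    apply: measurable_forall => i; apply: measurable_imply.
    apply: measurable_operators_gt0.
    apply: continuous_subf; first exact: continuous_cstf.
    apply/continuous_normf/continuous_subf; last exact: continuous_cstf.
    exact: ap_continuous.
  apply: measurable_operators_le0.
  apply: continuous_subf; last exact/continuous_mulcf/continuous_gap.
  apply/continuous_normf/continuous_subf; first exact: continuous_cstf.
  exact/continuous_mulcf/continuous_gap.
(* Multiplication by the gap, positive on this level, turns the condition on the height into one
   between functions continuous for the strong operator topology. *)
have heightE T : level d n k T ->
    (`|op_height dX X0 T - t%:R / m.+1%:R| <= m.+1%:R^-1) =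
    (`|1 - t%:R / m.+1%:R * gap d (ap T) n k| - m.+1%:R^-1 * gap d (ap T) n k <= 0).
  move=> l; have [bT wT] := (levelP dX X0 _ _ _).1 l; have [_ g0 _] := l.
  rewrite /op_height bT wT subr_le0 -ler_pdivrMr//; set G := gap d _ n k in g0 *.
  have -> : G^-1 - t%:R / m.+1%:R = (1 - t%:R / m.+1%:R * G) / G.
    by rewrite mulrBl mul1r mulfK// gt_eqF.
  by rewrite normf_div (gtr0_norm g0).
apply/seteqP; split=> T /=.
  move=> [l Te Th]; split=> //; split; last by rewrite -heightE.
  by move=> i im; rewrite subr_gt0 Te.
move=> [l [Te Th]]; split=> //; last by rewrite heightE.
by move=> i im; rewrite -subr_gt0 Te.
Qed.

Lemma op_base_ball (T : P) (r : R) : 0 < r ->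
  exists2 c, op_base c T & op_base c `<=` ball T r.
Proof.
move=> r0; have [m] := ltr_add_invr (divr_gt0 r0 (ltr0n R 2)); rewrite add0r => mr.
have {}mr : m.+1%:R^-1 + m.+1%:R^-1 < r by rewrite (splitr r) ltrD.
have /choice[a aP] : forall i, exists j, ball (ap T (d i)) (m.+1%:R^-1) (e j).
  by move=> i; apply: eY; rewrite invr_gt0.
have h0 : 0 <= op_height dX X0 T * m.+1%:R by rewrite mulr_ge0// ltW// op_height_gt0.
have [t tT] : exists t : nat, `|op_height dX X0 T - t%:R / m.+1%:R| <= m.+1%:R^-1.
  exists (Num.truncn (op_height dX X0 T * m.+1%:R)).
  have /andP[t1 t2] := truncn_itv h0.
  set H := op_height dX X0 T in t1 t2 *; set t := Num.truncn _ in t1 t2 *.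
  have -> : H - t%:R / m.+1%:R = (H * m.+1%:R - t%:R) / m.+1%:R.
    by rewrite mulrBl mulfK// pnatr_eq0.
  rewrite normrM (ger0_norm (_ : 0 <= m.+1%:R^-1)) ?invr_ge0// ler_piMl ?invr_ge0//.
  by rewrite ger0_norm ?subr_ge0// lerBlDr nat1r ltW.
have lT := (levelP dX X0 _ _ T).2 (conj erefl erefl).
exists (op_bound d T, op_witness dX X0 T, m, t, mkseq a m).
  split=> // i im; rewrite nth_mkseq//.
  by have := aP i; rewrite -ball_normE.
move=> S [/(levelP dX X0)[bS wS] Se Sh]; split; first by rewrite bS wS.
  (* The choice of [m] makes every coordinate tested by radius [r] one of the first [m]. *)
  move=> i ir; have im : (i < m)%N.
    rewrite ltnNge; apply/negP => mi; move: ir; apply/negP; rewrite -leNgt.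
    apply: (@le_trans _ _ (i.+1%:R * (m.+1%:R^-1 + m.+1%:R^-1))).
      rewrite mulrDr -mulrDl -natrD ler_pdivlMr// mul1r ler_nat.
      by rewrite (leq_trans (_ : _ <= i.+1)%N)// leq_addr.
    by rewrite ler_pM2l// ltW.
  rewrite -(subrKA (e (a i))); apply: (le_lt_trans (ler_normD _ _)).
  apply: lt_trans mr; apply: ltrD; first by have := aP i; rewrite -ball_normE.
  by rewrite distrC; have := Se i im; rewrite nth_mkseq.
rewrite -(subrKA (t%:R / m.+1%:R)); apply: (le_lt_trans (ler_normD _ _)).
by apply: le_lt_trans mr; apply: lerD => //; rewrite distrC.
Qed.

Lemma measurable_polish_open (U : set P) : open U -> measurable (U : set (opspace X Y)).
Proof.
move=> oU; rewrite [X in measurable X](_ : _ = [set T | exists c,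
    (op_base c `&` [set S : P | op_base c `<=` U]) T]).
  apply: measurable_exists => c; have [cU|ncU] := pselect (op_base c `<=` U).
    rewrite [X in measurable X](_ : _ = op_base c); first exact: measurable_op_base.
    by apply/seteqP; split=> T; [move=> []|].
  by rewrite [X in measurable X](_ : _ = set0)//; apply/seteqP; split=> T// [].
apply/seteqP; split=> T /= => [UT|[c [cT]]]; last exact.
have [r r0 rU] := (nbhs_ballP _ _).1 (open_nbhs_nbhs (conj oU UT)).
have [c cT cr] := op_base_ball T r0.
by exists c; split=> // S /cr/rU.
Qed.

Lemma polish_operators_separable : separable P.
Proof.
exists (range (fun c => xget point (op_base c))).
  apply: sub_countable (card_image_le _ _) _; exact: countableP.
move=> U [T UT] oU; have [r r0 rU] := (nbhs_ballP _ _).1 (open_nbhs_nbhs (conj oU UT)).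
have [c cT cr] := op_base_ball T r0.
exists (xget point (op_base c)); split; last by exists c.
by apply/rU/cr; apply: (xgetPex point); exists T.
Qed.

Lemma opspace_standard_borel_seq : standard_borel (opspace X Y) R.
Proof.
exists P, id; split.
- exact: polish_operators_hausdorff.
- exact: polish_operators_separable.
- by exists id.
apply/seteqP; split=> [A mA|_ [B sB <-]].
  exists A => //; apply: smallest_sub mA; first exact: smallest_sigma_algebra.
  by move=> U oU; apply: sub_sigma_algebra; exact: sot_open_polish.
rewrite preimage_id; apply: smallest_sub sB; last exact: measurable_polish_open.
exact: sigma_algebra_measurable.
Qed.

End operators_standard_borel.

Lemma opspace_standard_borel (R : realType) (X Y : completeNormedModType R) :
  separable X -> separable Y -> (exists x : X, x != 0) ->
  standard_borel (opspace X Y) R.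
Proof.
move=> /dense_seq[d dX] /dense_seq[e eY] X0.
exact: (opspace_standard_borel_seq dX eY X0).
Qed.

(** * Linearly independent sequences *)

Section combinations.
Variables (R : realType) (X : completeNormedModType R).
Implicit Types (v x : nat -> X) (a b : nat -> R).

Definition comb v a n : X := \sum_(i < n) a i *: v i.

Lemma combS v a n : comb v a n.+1 = comb v a n + a n *: v n.
Proof. by rewrite /comb big_ord_recr. Qed.

Lemma comb_eq v a b n : (forall i, (i < n)%N -> a i = b i) -> comb v a n = comb v b n.
Proof. by move=> ab; apply: eq_bigr => i _; rewrite ab. Qed.

Lemma combB v a b n : comb v (fun i => a i - b i) n = comb v a n - comb v b n.
Proof. by rewrite /comb -sumrB; apply: eq_bigr => i _; rewrite scalerBl. Qed.

Lemma combZ v c a n : comb v (fun i => c * a i) n = c *: comb v a n.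
Proof. by rewrite /comb scaler_sumr; apply: eq_bigr => i _; rewrite scalerA. Qed.

Lemma combZD v c a b n :
  comb v (fun i => c * a i + b i) n = c *: comb v a n + comb v b n.
Proof.
by rewrite -combZ /comb -big_split; apply: eq_bigr => i _; rewrite scalerDl.
Qed.

Lemma comb_extend v a n m : (n <= m)%N ->
  comb v (fun i => if (i < n)%N then a i else 0) m = comb v a n.
Proof.
elim: m => [|m IH]; first by rewrite leqn0 => /eqP ->; rewrite /comb !big_ord0.
rewrite leq_eqVlt => /predU1P[->|]; first by apply: comb_eq => i ->.
by rewrite ltnS combS => nm; rewrite ltnNge nm /= scale0r addr0 IH.
Qed.

Lemma cvg_comb (T : Type) (F : set_system T) (FF : Filter F) (u : T -> nat -> X)
    (b : T -> nat -> R) x a n :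
  (forall i, (fun t => u t i) @ F --> x i) ->
  (forall i, (i < n)%N -> (fun t => b t i) @ F --> a i) ->
  (fun t => comb (u t) (b t) n) @ F --> comb x a n.
Proof.
move=> ux; elim: n => [|n IH] ba.
  rewrite /comb big_ord0 (_ : (fun _ => _) = cst 0); first exact: cvg_cst.
  by apply/funext => t; rewrite big_ord0.
rewrite combS (_ : (fun _ => _) = fun t => comb (u t) (b t) n + b t n *: u t n).
  apply: cvgD; first by apply: IH => i ni; apply: ba; rewrite ltnS ltnW.
  by apply: cvgZ; [exact: ba|exact: ux].
by apply/funext => t; rewrite combS.
Qed.

Definition independent x : Prop := forall n a, x n <> comb x a n.

(** Induction on [n]: the essential point is that [x n] has positive distance [dl] from the span of
    its predecessors. *)
Lemma independent_lower x n : independent x ->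
  exists2 C : R, 0 < C & forall a i, (i < n)%N -> `|a i| <= C * `|comb x a n|.
Proof.
move=> ix; elim: n => [|n [C C0 CP]]; first by exists 1.
have [dl dl0 dlP] : exists2 dl : R, 0 < dl & forall a, dl <= `|x n - comb x a n|.
  apply: contrapT => h.
  (* Were the distance zero, the coefficients of approximating combinations would be Cauchy by the
     induction hypothesis, and their limits would put [x n] in the span. *)
  have /choice[s sP] : forall m, exists a, `|x n - comb x a n| < m.+1%:R^-1.
    move=> m; apply: contrapT => /forallNP hm; apply: h.
    exists (m.+1%:R^-1); first by rewrite invr_gt0.
    by move=> a; have /negP := hm a; rewrite -leNgt.
  have s0 : (fun m => comb x (s m) n) @ \oo --> x n.
    apply/cvgrPdist_lt => e e0; have [j] := ltr_add_invr (e0 : 0 < e); rewrite add0r => je.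
    exists j => // m /= jm; apply: lt_trans (sP m) _; apply: le_lt_trans je.
    by rewrite lef_pV2 ?posrE// ler_nat.
  have sc i : (i < n)%N -> cvg ((fun m => s m i) @ \oo).
    move=> ni; apply/cauchy_cvgP/cauchy_exP => e e0.
    have [|j] := @ltr_add_invr R 0 (e / (C * 2)); first by rewrite divr_gt0// mulr_gt0.
    rewrite add0r => je; exists (s j i); exists j => // m /= jm; rewrite -ball_normE /=.
    apply: (le_lt_trans (CP (fun i => s j i - s m i) i ni)).
    rewrite combB -ltr_pdivlMl// -(subrKA (x n)).
    apply: (le_lt_trans (ler_normD _ _)); rewrite (distrC _ (x n)).
    have -> : C^-1 * e = e / (C * 2) + e / (C * 2) by field; rewrite gt_eqF.
    apply: ltrD; apply: lt_trans (sP _) _ => //; apply: le_lt_trans je.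
    by rewrite lef_pV2 ?posrE// ler_nat.
  apply: (ix n (fun i => lim ((fun m => s m i) @ \oo))).
  apply: (@cvg_unique _ (@norm_hausdorff _ X) _ _ _ _ s0).
  apply: (@cvg_comb _ _ _ (fun=> x) s x); first by move=> i; exact: cvg_cst.
  by move=> i /sc.
have an a : `|a n| <= dl^-1 * `|comb x a n.+1|.
  have [->|an0] := eqVneq (a n) 0; first by rewrite normr0 mulr_ge0// invr_ge0 ltW.
  rewrite ler_pdivlMl// combS.
  have -> : comb x a n + a n *: x n = a n *: (x n - comb x (fun i => - (a n)^-1 * a i) n).
    by rewrite combZ scaleNr opprK scalerDr scalerA mulfV// scale1r addrC.
  by rewrite normrZ mulrC ler_wpM2l.
(* The first term bounds the new coefficient; the second bounds the old ones, after the last vector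
   is removed from the combination. *)
exists (dl^-1 + C * (1 + dl^-1 * `|x n|)).
  by rewrite addr_gt0 ?invr_gt0// mulr_gt0// ltr_pwDl// mulr_ge0// invr_ge0 ltW.
move=> a i; rewrite ltnS leq_eqVlt => /predU1P[->|ni].
  apply: (le_trans (an a)); rewrite mulrDl lerDl mulr_ge0//.
  by rewrite mulr_ge0 ?ltW// ltr_pwDl// mulr_ge0// invr_ge0 ltW.
apply: (le_trans (CP a i ni)); apply: (@le_trans _ _ (C * ((1 + dl^-1 * `|x n|) * `|comb x a n.+1|))).
  rewrite ler_pM2l//; have -> : comb x a n = comb x a n.+1 - a n *: x n by rewrite combS addrK.
  apply: (le_trans (ler_normB _ _)); rewrite normrZ mulrDl mul1r lerD2l.
  by rewrite mulrAC ler_wpM2r.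
by rewrite mulrA ler_wpM2r// lerDr invr_ge0 ltW.
Qed.

(* A rescaled independent sequence has its last coordinate bounded by the norm,
   a condition that passes to limits. *)
Definition spread x : Prop := forall n a, `|a n| <= `|comb x a n.+1|.

Lemma independent_spread x : independent x ->
  exists2 c : nat -> R, (forall n, 0 < c n) & spread (fun n => c n *: x n).
Proof.
move=> ix.
have /choice[C CP] : forall n, exists C : R, 0 < C /\
    forall a, `|a n| <= C * `|comb x a n.+1|.
  by move=> n; have [C C0 CP] := independent_lower n.+1 ix; exists C; split=> // a; exact: CP.
exists C => [n|n a]; first by have [] := CP n.
have [C0 CnP] := CP n.
have := CnP (fun i => a i * C i); rewrite normrM (gtr0_norm C0) mulrC ler_pM2l//.
by rewrite /comb; under eq_bigr do rewrite -scalerA.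
Qed.

Lemma spread_coef0 x a n : spread x -> comb x a n = 0 ->
  forall i, (i < n)%N -> a i = 0.
Proof.
move=> sx; elim: n => // n IH xan.
have an : a n = 0 by apply/eqP; rewrite -normr_le0 -(normr0 X) -xan; exact: sx.
move=> i; rewrite ltnS leq_eqVlt => /predU1P[->//|]; apply: IH.
by move: xan; rewrite combS an scale0r addr0.
Qed.

Lemma lspan_seqP (s : seq X) (v : X) : lspan [set` s] v ->
  exists b : nat -> R, v = \sum_(j < size s) b j *: s`_j.
Proof.
move=> [n [a [u [us ->]]]].
exists (fun j => \sum_(i < n | index (u i) s == j) a i).
under [RHS]eq_bigr do rewrite scaler_suml.
rewrite (exchange_big_dep xpredT)//=; apply: eq_bigr => i _.
have ui := us i.
have uis : (index (u i) s < size s)%N by rewrite index_mem.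
rewrite (big_pred1 (Ordinal uis)) /=; last by move=> j /=; rewrite eq_sym -(inj_eq val_inj).
by rewrite nth_index.
Qed.

(** Expanding [size s + 1] of the vectors over [size s] generators gives a matrix with a nonzero
    left kernel, that is, a vanishing nontrivial combination. *)
Lemma spread_not_finite_dimensional x (V : set X) : spread x ->
  (forall n, V (x n)) -> ~ finite_dimensional V.
Proof.
move=> sx Vx [A /finite_seqP[s ->] VA].
have /choice[b bP] : forall i, exists b : nat -> R, x i = \sum_(j < size s) b j *: s`_j.
  by move=> i; apply: lspan_seqP; rewrite -VA.
pose M : 'M[R]_((size s).+1, size s) := \matrix_(i, j) b i j.
have [w wM w0] : exists2 w : 'rV[R]_(size s).+1, w *m M = 0 & w != 0.
  have : kermx M != 0.
    by rewrite -mxrank_eq0 mxrank_ker -lt0n subn_gt0 ltnS rank_leq_col.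
  move=> /rowV0Pn[w /sub_kermxP wM w0]; by exists w.
move/negP: w0; apply; apply/eqP/rowP => i; rewrite mxE.
pose a k := w 0 (inord k).
have ai : a i = w 0 i by rewrite /a inord_val.
rewrite -ai; apply: (@spread_coef0 x a (size s).+1 sx) => //.
rewrite /comb; under eq_bigr do rewrite bP scaler_sumr.
rewrite exchange_big /= big1// => j _.
under eq_bigr do rewrite scalerA.
rewrite -scaler_suml (_ : \sum_(k < (size s).+1) a k * b k j = 0) ?scale0r//.
move/rowP: wM => /(_ j); rewrite !mxE => {2}<-; apply: eq_bigr => k _.
by rewrite mxE /a inord_val.
Qed.

Lemma infinite_dimensional_independent (V : set X) : linear_subspace V ->
  ~ finite_dimensional V -> exists2 x, independent x & forall n, V (x n).
Proof.
move=> [V0 VD] nV.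
have Vsum n (a : 'I_n -> R) (u : 'I_n -> X) : (forall i, V (u i)) ->
    V (\sum_(i < n) a i *: u i).
  elim: n a u => [|n IH] a u Vu; first by rewrite big_ord0.
  by rewrite big_ord_recl; apply: VD => //; apply: IH.
have /choice[next nextP] : forall s : seq X, exists y,
    [set` s] `<=` V -> V y /\ ~ lspan [set` s] y.
  move=> s; have [sV|] := pselect ([set` s] `<=` V); last by exists 0.
  apply: contrapT => /forallNP h; apply: nV; exists [set` s].
    by apply/finite_seqP; exists s.
  apply/seteqP; split=> [y Vy|y [n [a [u [us ->]]]]].
    by apply: contrapT => nys; apply: (h y).
  by apply: Vsum => i; exact/sV/us.
pose u := fix u n := if n is m.+1 then rcons (u m) (next (u m)) else [::].
have uV n : [set` u n] `<=` V.
  elim: n => // n IH y /=; rewrite mem_rcons inE => /predU1P[->|/IH//].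
  by have [] := nextP _ IH.
have ux m n : (m < n)%N -> next (u m) \in u n.
  elim: n => // n IH; rewrite ltnS leq_eqVlt /= mem_rcons inE => /predU1P[->|/IH ->].
    by rewrite eqxx.
  by rewrite orbT.
exists (fun n => next (u n)) => n; last by have [] := nextP _ (uV n).
move=> a E; have [_] := nextP _ (uV n); apply.
by exists n, a, (fun i => next (u i)); split=> // i; exact: ux.
Qed.

(** A dependence would give [x n] two expansions: itself, and a combination of its predecessors. *)
Lemma basic_sequence_independent x : (forall n, x n != 0) -> basic_sequence x ->
  independent x.
Proof.
move=> x0 bx n a xna.
have [|c [_ uc]] := bx (x n).
  apply: subset_closure; exists 1%N, (fun=> 1), (fun=> x n); split; first by exists n.
  by rewrite big_ord1 scale1r.
pose a1 i : R := (i == n)%:R; pose a2 i : R := if (i < n)%N then a i else 0.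
suff [E1 E2] : c = a1 /\ c = a2.
  have : a1 n = a2 n by rewrite -E1 -E2.
  by rewrite /a1 /a2 eqxx ltnn => /eqP; rewrite oner_eq0.
have serE b m : series (fun k => b k *: x k) m = comb x b m.
  by rewrite /series /= big_mkord.
split; apply: uc; apply: cvg_near_cst; exists n.+1 => // m /= nm; rewrite serE.
  have -> : comb x a1 m = comb x (fun i => if (i < n.+1)%N then a1 i else 0) m.
    apply: comb_eq => i _; case: ifPn => //; rewrite -leqNgt => ni.
    by rewrite /a1 gtn_eqF.
  rewrite comb_extend// combS /a1 eqxx scale1r /comb big1 ?add0r// => i _.
  by rewrite ltn_eqF// scale0r.
by rewrite /a2 comb_extend// ltnW.
Qed.

End combinations.

(** * The tree of an operator *)

Section ss_tree.
Variables (R : realType) (X Y : completeNormedModType R) (d : nat -> X).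
Hypothesis dX : forall x (e : R), 0 < e -> exists n, ball x e (d n).

(** One letter codes a finite list of indices, so that each stage re-approximates all earlier
    vectors. *)
Definition letter_vec (k i : nat) : X :=
  d (nth 0%N (odflt [::] (choice.unpickle k : option (seq nat))) i).

(* The letters [b 0, b 1, ...] code approximations, with precision [eps j] at
   stage [j], of a spread sequence of vectors on whose span [T] is bounded
   below by [q.+1%:R^-1]. *)
Definition ss_cauchy (b : nat -> nat) (n : nat) : Prop :=
  forall j j' i, (i <= j)%N -> (j <= j')%N -> (j' < n)%N ->
    `|letter_vec (b j) i - letter_vec (b j') i| <= eps j.

Definition ss_spread (b : nat -> nat) (n : nat) : Prop :=
  forall j i a, (j < n)%N -> (i <= j)%N ->
    `|a i| <= `|comb (letter_vec (b j)) a i.+1| + eps j * \sum_(h < i.+1) `|a h|.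

(** The slack has the factor [q + 1]: [q] for the image of the approximation error under an operator
    bounded by [q], and 1 for the error on the left side. *)
Definition ss_below (T : X -> Y) (q : nat) (b : nat -> nat) (n : nat) : Prop :=
  forall j a, (j < n)%N ->
    q.+1%:R^-1 * `|comb (letter_vec (b j)) a j.+1| <=
    `|T (comb (letter_vec (b j)) a j.+1)| + q.+1%:R * eps j * \sum_(h < j.+1) `|a h|.

Definition ss_node T q b n : Prop :=
  [/\ ss_cauchy b n, ss_spread b n & ss_below T q b n].

Definition ss_tree (T : X -> Y) : set (seq nat) :=
  [set p | if p is q :: l then ss_node T q (nth 0%N l) (size l) else True].

Lemma ss_node_le T q b b' m n : agree m b b' -> (m <= n)%N ->
  ss_node T q b n -> ss_node T q b' m.
Proof.
move=> bb' mn [h1 h2 h3]; split.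
- move=> j j' i ij jj' jm; rewrite -!bb'//; last exact: leq_ltn_trans jm.
  exact: h1 (leq_trans jm mn).
- by move=> j i a jm ij; rewrite -bb'//; apply: h2 => //; exact: leq_trans mn.
- by move=> j a jm; rewrite -bb'//; apply: h3; exact: leq_trans mn.
Qed.

Lemma ss_tree_tree T : is_tree (ss_tree T).
Proof.
split=> // -[|q l] a //=; apply: ss_node_le; last by rewrite size_rcons.
by move=> i il; rewrite nth_rcons il.
Qed.

Lemma ss_tree_mkseq T b n : ss_tree T (mkseq b n.+1) <->
  ss_node T (b 0%N) (b \o S) n.
Proof.
have -> : mkseq b n.+1 = b 0%N :: mkseq (b \o S) n.
  by rewrite /mkseq /= -[1%N]addn0 iotaDl -map_comp.
by rewrite /ss_tree /= size_mkseq; split; apply: ss_node_le => // i ni;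
  rewrite nth_mkseq.
Qed.

Lemma measurable_ss_tree p :
  measurable [set T : opspace X Y | ss_tree (op_fun T) p].
Proof.
case: p => [|q l].
  by rewrite [X in measurable X](_ : _ = setT)//; apply/seteqP; split.
pose b := nth 0%N l; pose n := size l.
have mB : measurable [set T : opspace X Y | ss_below (op_fun T) q b n].
  have mj j : measurable [set T : opspace X Y | forall a,
      q.+1%:R^-1 * `|comb (letter_vec (b j)) a j.+1| <=
      `|op_fun T (comb (letter_vec (b j)) a j.+1)|
        + q.+1%:R * eps j * \sum_(h < j.+1) `|a h|].
    rewrite -[X in measurable X]setCK; apply: measurableC; apply: sub_sigma_algebra.
    (* The coefficients [a] range over an uncountable set, but failure for a given [a] is an open
       condition, and unions of open sets are open. *)
    rewrite (_ : ~` _ = \bigcup_a [set T : operators X Y | 0 <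
      (q.+1%:R^-1 * `|comb (letter_vec (b j)) a j.+1| - q.+1%:R * eps j * \sum_(h < j.+1) `|a h|) -
      `|ap T (comb (letter_vec (b j)) a j.+1)|]).
      apply: bigcup_open => a _.
      apply: ((continuousP _).1 _ _ (@open_gt R 0)).
      by apply: continuous_subf; [exact: continuous_cstf|exact: continuous_norm_ap].
    apply/seteqP; split=> T /=.
      move=> /existsNP[a /negP]; rewrite -ltNge => h; exists a => //=.
      by rewrite subr_gt0 ltrBrDr.
    by move=> [a _ /=]; rewrite subr_gt0 ltrBrDr ltNge => /negP h h'; exact: h.
  rewrite [X in measurable X](_ : _ = [set T : opspace X Y | forall j, (j < n)%N -> forall a,
      q.+1%:R^-1 * `|comb (letter_vec (b j)) a j.+1| <=
      `|op_fun T (comb (letter_vec (b j)) a j.+1)|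
        + q.+1%:R * eps j * \sum_(h < j.+1) `|a h|]).
    by apply: measurable_forall => j; apply: measurable_imply; exact: mj.
  by apply/seteqP; split=> T /= h j; [move=> jn a|move=> a jn]; exact: h.
have [[h1 h2]|h] := pselect (ss_cauchy b n /\ ss_spread b n).
  rewrite [X in measurable X](_ : _ = [set T : opspace X Y | ss_below (op_fun T) q b n])//.
  by apply/seteqP; split=> T /=; [move=> []|split].
rewrite [X in measurable X](_ : _ = set0)//; apply/seteqP; split=> T //= [? ? _].
by apply: h.
Qed.

Lemma ss_tree_branch (T : operators X Y) :
  ~ wf_tree (ss_tree (ap T)) -> ~ strictly_singular (ap T).
Proof.
move=> /contrapT[b Tb] Tss.
pose q := b 0%N; pose c := b \o S.
have Tc n : ss_node (ap T) q c n by apply/ss_tree_mkseq.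
have cc i : cvg ((fun j => letter_vec (c j) i) @ \oo).
  apply/cauchy_cvgP/cauchy_exP => e /eps_lt[j je].
  exists (letter_vec (c (maxn i j)) i); exists (maxn i j) => // k /= jk.
  rewrite -ball_normE /=; have [h _ _] := Tc k.+1.
  apply: le_lt_trans (h _ _ _ (leq_maxl i j) jk (ltnSn k)) _.
  by apply: le_lt_trans je; rewrite eps_le// leq_maxr.
pose x i := lim ((fun j => letter_vec (c j) i) @ \oo).
have xc i : (fun j => letter_vec (c j) i) @ \oo --> x i by exact: cc.
have combc a n : (fun j => comb (letter_vec (c j)) a n) @ \oo --> comb x a n.
  by apply: cvg_comb => // i _; exact: cvg_cst.
have epsc (K : R) : (fun j => eps j * K) @ \oo --> 0.
  by rewrite -[X in _ --> X](mul0r K); apply: cvgM; [exact: cvg_eps|exact: cvg_cst].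
have sx : spread x.
  move=> n a; rewrite -[X in _ <= X]addr0.
  apply: (@cvgr_to_ge _ \oo _ R (fun j => `|comb (letter_vec (c j)) a n.+1| +
    eps j * \sum_(h < n.+1) `|a h|)).
    by apply: cvgD; [exact: cvg_norm|exact: epsc].
  by exists n => // j /= nj; have [_ h _] := Tc j.+1; exact: h.
have [M MP] := ap_bounded T.
have Tcomb a n : (fun j => ap T (comb (letter_vec (c j)) a n)) @ \oo --> ap T (comb x a n).
  apply/cvgrPdist_le => e e0.
  have M0 : 0 < `|M| + 1 by rewrite ltr_wpDl.
  have /cvgrPdist_le/(_ (e / (`|M| + 1))) := combc a n.
  move=> /(_ (divr_gt0 e0 M0)); apply: filterS => j je.
  rewrite -apB; apply: (le_trans (MP _)).
  apply: (@le_trans _ _ ((`|M| + 1) * `|comb x a n - comb (letter_vec (c j)) a n|)).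
    by rewrite ler_wpM2r// (le_trans (ler_norm M))// lerDl.
  by rewrite -ler_pdivlMl// mulrC.
have below a n : q.+1%:R^-1 * `|comb x a n| <= `|ap T (comb x a n)|.
  (* Stage [j] speaks of [j + 1] vectors; padding by zeros applies it to [n] vectors with an error
     sum [K] independent of [j]. *)
  pose a' i := if (i < n)%N then a i else 0.
  pose K : R := \sum_(h < n) `|a h|.
  have Kj j : (n <= j)%N -> \sum_(h < j.+1) `|a' h| = K.
    move=> nj; rewrite /K (big_ord_widen j.+1 (fun h => `|a h|)) ?leqW//.
    rewrite [RHS]big_mkcond/=; apply: eq_bigr => h _.
    by rewrite /a'; case: ifP => //; rewrite normr0.
  rewrite -subr_ge0.
  apply: (@cvgr_to_ge _ \oo _ R (fun j => `|ap T (comb (letter_vec (c j)) a n)| -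
    q.+1%:R^-1 * `|comb (letter_vec (c j)) a n| + eps j * (q.+1%:R * K))).
    rewrite -[X in _ --> X]addr0; apply: cvgD; last exact: epsc.
    apply: cvgB; first exact: cvg_norm.
    by apply: cvgM; [exact: cvg_cst|exact: cvg_norm].
  exists n => // j /= nj; have [_ _ h] := Tc j.+1.
  have := h j a' (ltnSn j); rewrite comb_extend ?leqW// Kj// => {}h.
  rewrite addrAC subr_ge0; apply: le_trans h _.
  by rewrite lerD2l mulrCA mulrA.
have spanE v : lspan (range x) v -> exists a n, v = comb x a n.
  move=> [n [a [u [ux ->]]]].
  have /choice[k kP] : forall i, exists k, x k = u i by move=> i; have [k _] := ux i; exists k.
  pose N := (\max_(i < n) (k i).+1)%N.
  have kN i : (k i < N)%N by exact: (@leq_bigmax _ (fun j : 'I_n => (k j).+1) i).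
  exists (fun j => \sum_(i < n | k i == j) a i), N; rewrite /comb.
  under [RHS]eq_bigr do rewrite scaler_suml.
  rewrite (exchange_big_dep xpredT)//=; apply: eq_bigr => i _.
  by rewrite (big_pred1 (Ordinal (kN i))) -?kP// => j /=; rewrite eq_sym -(inj_eq val_inj).
have combspan a n : lspan (range x) (comb x a n).
  by exists n, (fun i => a i), (fun i => x i); split=> [i|]; [exists i|].
apply: (Tss (lspan (range x))).
- split; first by exists 0%N, (fun=> 0), (fun=> 0); split; [case|rewrite big_ord0].
  move=> r u v /spanE[a [n ->]] /spanE[b' [m ->]].
  rewrite -(comb_extend x a (leq_maxl n m)) -(comb_extend x b' (leq_maxr n m)) -combZD.
  exact: combspan.
- apply: (spread_not_finite_dimensional sx) => n.
  by exists 1%N, (fun=> 1), (fun=> x n); split; [exists n|rewrite big_ord1 scale1r].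
- exists q.+1%:R^-1, (`|M| + 1); split; first by rewrite invr_gt0.
    by rewrite ltr_wpDl.
  move=> v /spanE[a [n ->]]; rewrite below /=; apply: (le_trans (MP _)).
  by rewrite ler_wpM2r// (le_trans (ler_norm M))// lerDl.
Qed.

(** The index [ee a j] names a dense vector approximating vector [a] at stage [j]. Used as the last
    letter of the image of [l], this re-approximates every vector chosen so far at stage
    [(size l).-1]. *)
Definition approx_letter (ee : nat -> nat -> nat) (l : seq nat) : nat :=
  choice.pickle [seq ee a (size l).-1 | a <- l].

Lemma approx_vecE ee l j i : (j < size l)%N -> (i <= j)%N ->
  letter_vec (nth 0%N (seq_map (approx_letter ee) l) j) i = d (ee (nth 0%N l i) j).
Proof.
move=> jl ij; rewrite /seq_map nth_mkseq// /letter_vec /approx_letter choice.pickleK.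
by rewrite (nth_map 0%N) ?size_takel//= nth_take.
Qed.

Lemma comb_dist_le (u v : nat -> X) a n (e : R) :
  (forall i, (i < n)%N -> `|u i - v i| <= e) ->
  `|comb u a n - comb v a n| <= e * \sum_(h < n) `|a h|.
Proof.
move=> uv; rewrite /comb -sumrB mulr_sumr; apply: (le_trans (ler_norm_sum _ _ _)).
by apply: ler_sum => i _; rewrite -scalerBr normrZ mulrC ler_wpM2r// uv.
Qed.

(** As [l] increases, the last vector of the subsequence also comes last in [z]; the coefficients
    are moved to their positions in [z] and [spread z] applies there. *)
Lemma spread_subseq (z : nat -> X) (l : seq nat) a i : spread z -> sorted ltn l ->
  (i < size l)%N -> `|a i| <= `|comb (fun h => z (nth 0%N l h)) a i.+1|.
Proof.
move=> sz sl il.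
have lle h : (h < i.+1)%N -> (nth 0%N l h < (nth 0%N l i).+1)%N.
  rewrite ltnS => hi; apply: (sorted_leq_nth leq_trans leqnn) => //; rewrite ?inE//.
    by apply: sub_sorted sl => m n /ltnW.
  exact: leq_ltn_trans il.
pose a' k : R := \sum_(h < i.+1 | nth 0%N l h == k) a h.
have <- : a' (nth 0%N l i) = a i.
  rewrite /a' (big_pred1 ord_max)// => h /=.
  rewrite nth_uniq//; first by apply: leq_ltn_trans il; rewrite -ltnS.
  exact: (sorted_uniq ltn_trans ltnn).
suff <- : comb z a' (nth 0%N l i).+1 = comb (fun h => z (nth 0%N l h)) a i.+1 by exact: sz.
rewrite /comb; under eq_bigr do rewrite /a' scaler_suml.
rewrite (exchange_big_dep xpredT)//=; apply: eq_bigr => h _.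
by rewrite (big_pred1 (Ordinal (lle h (ltn_ord h)))) => // j /=;
  rewrite eq_sym -(inj_eq val_inj).
Qed.

Lemma ss_tree_approx (T : operators X Y) q z ee l : spread z ->
  (forall a j, ball (z a) (eps j / 2) (d (ee a j))) ->
  (forall x, `|ap T x| <= q%:R * `|x|) -> sorted ltn l ->
  (forall a, let v := comb (fun i => z (nth 0%N l i)) a (size l) in
     q.+1%:R^-1 * `|v| <= `|ap T v|) ->
  ss_tree (ap T) (q :: seq_map (approx_letter ee) l).
Proof.
move=> sz zee Tq sl Tl; pose y i := z (nth 0%N l i).
have szl : size (seq_map (approx_letter ee) l) = size l by rewrite size_mkseq.
have near j i : (j < size l)%N -> (i <= j)%N ->
    `|y i - letter_vec (nth 0%N (seq_map (approx_letter ee) l) j) i| <= eps j / 2.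
  move=> jl ij; rewrite approx_vecE//; have := zee (nth 0%N l i) j.
  by rewrite -ball_normE => /ltW.
have half j : eps j / 2 <= eps j :> R by rewrite ler_pdivrMr// ler_peMr ?eps_ge0// ler1n.
rewrite /ss_tree /= szl; split.
- move=> j j' i ij jj' jl; have jl' := leq_ltn_trans jj' jl.
  rewrite -(subrKA (y i)) (splitr (eps j)); apply: (le_trans (ler_normD _ _)).
  apply: lerD; first by rewrite distrC near.
  apply: le_trans (near _ _ jl (leq_trans ij jj')) _.
  by rewrite ler_pM2r// eps_le.
- move=> j i a jl ij.
  apply: le_trans (spread_subseq a sz sl (leq_ltn_trans ij jl)) _.
  rewrite -/y -[X in `|X|](subrK (comb (letter_vec (nth 0%N (seq_map (approx_letter ee) l) j)) a i.+1)).
  rewrite addrC; apply: (le_trans (ler_normD _ _)); rewrite lerD2l.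
  apply: comb_dist_le => h hi; apply: le_trans (half j).
  by apply: near => //; exact: leq_trans ij.
move=> j a jl.
set u := comb _ a _; set K := \sum_(h < j.+1) _; pose w := comb y a j.+1.
have wu : `|w - u| <= eps j * K.
  apply: comb_dist_le => h hj; apply: le_trans (half j).
  exact: near.
have Tw : q.+1%:R^-1 * `|w| <= `|ap T w|.
  (* The lower bound on the span of all of [l] is used for its first [j + 1] vectors. *)
  have := Tl (fun i => if (i < j.+1)%N then a i else 0).
  by rewrite /= comb_extend.
have q1 : q.+1%:R^-1 <= 1 :> R by rewrite invf_le1 ?ltr0n// ler1n.
apply: (@le_trans _ _ (q.+1%:R^-1 * `|w| + eps j * K)).
  apply: (@le_trans _ _ (q.+1%:R^-1 * (`|w| + eps j * K))).
    rewrite ler_pM2l ?invr_gt0// (_ : `|u| = `|w - (w - u)|); last by rewrite subKr.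
    by rewrite (le_trans (ler_normB _ _))// lerD2l.
  rewrite mulrDr lerD2l ler_piMl//.
  by rewrite mulr_ge0 ?eps_ge0// sumr_ge0.
apply: (@le_trans _ _ (`|ap T w| + eps j * K)); first by rewrite lerD2r.
have -> : `|ap T u| + q.+1%:R * eps j * K = `|ap T u| + q%:R * (eps j * K) + eps j * K.
  by rewrite -natr1; ring.
rewrite lerD2r addrC (_ : ap T w = ap T (w - u) + ap T u); last by rewrite apB subrK.
apply: (le_trans (ler_normD _ _)); rewrite lerD2r; apply: (le_trans (Tq _)).
by rewrite ler_wpM2l.
Qed.

Lemma op_index (T : operators X Y) (c : R) : 0 < c ->
  exists2 q : nat, forall x, `|ap T x| <= q%:R * `|x| & q.+1%:R^-1 <= c.
Proof.
move=> c0; have [M MP] := ap_bounded T; have [j jc] := eps_lt c0.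
exists (maxn (Num.bound `|M|) j) => [x|].
  apply: (le_trans (MP x)); rewrite ler_wpM2r//.
  apply: (le_trans (ler_norm M)); apply: (le_trans (ltW (archi_boundP _))) => //.
  by rewrite ler_nat leq_maxl.
by apply: le_trans (ltW jc); apply: eps_le; rewrite leq_maxr.
Qed.

Lemma dense_approx (z : nat -> X) :
  exists ee, forall a j, ball (z a) (eps j / 2) (d (ee a j)).
Proof.
have /choice[f fP] : forall aj : nat * nat, exists n, ball (z aj.1) (eps aj.2 / 2) (d n).
  by move=> aj; apply: dX; rewrite divr_gt0// eps_gt0.
by exists (fun a j => f (a, j)) => a j; exact: (fP (a, j)).
Qed.

Lemma ss_tree_ill_founded (T : operators X Y) :
  ~ strictly_singular (ap T) -> ~ wf_tree (ss_tree (ap T)).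
Proof.
move=> /existsNP[V /not_implyP[linV /not_implyP[infV /contrapT[c [C [c0 C0 TV]]]]]].
have [x /independent_spread[t t0 sz] Vx] := infinite_dimensional_independent linV infV.
pose z n := t n *: x n.
have Vz n : V (z n) by rewrite /z -[X in V X]addr0; apply: linV.2 => //; exact: linV.1.
have Vcomb (a : nat -> R) n : V (comb z a n).
  elim: n => [|n IH]; first by rewrite /comb big_ord0; exact: linV.1.
  by rewrite combS addrC; apply: linV.2.
have [ee eeP] := dense_approx z.
have [q qT qc] := op_index T c0.
move=> Twf; apply: Twf.
(* The branch follows the whole sequence [z], with indices 0, 1, 2 and so on, after the first letter
   [q]. *)
pose b n := if n is m.+1 then approx_letter ee (mkseq id m.+1) else q.
exists b; case=> [//|n].
have -> : mkseq b n.+1 = q :: seq_map (approx_letter ee) (mkseq id n).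
  by rewrite seq_map_mkseq /mkseq /= -[1%N]addn0 iotaDl -map_comp.
apply: ss_tree_approx eeP qT _ _ => //.
  by rewrite /mkseq map_id iota_ltn_sorted.
move=> a /=; set v := comb _ _ _.
have Vv : V v.
  rewrite /v size_mkseq (_ : comb _ _ _ = comb z a n)//; apply: eq_bigr => i _.
  by rewrite nth_mkseq.
have /andP[Tv _] := TV v Vv; apply: le_trans Tv.
by rewrite ler_wpM2r.
Qed.

End ss_tree.

(** * Schreier families *)

Section schreier_rank.
Variables (s : omega1 -> nat -> omega1) (hs : fundamental_sequences s).

Lemma schreier_fset1 xi a : (ord_one <= xi)%O -> (0 < a)%N ->
  schreier s xi [fset a]%fset.
Proof.
move=> + a0; elim/omega1_ind: xi => xi IH xi1.
have min1 n : (n <= a)%N -> le_fset_min n [fset a]%fset.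
  by move=> na b; rewrite inE => /eqP ->.
have [xi0|[ze zexi xiE]|lxi] := ord_trichotomy xi.
- by move/ord_one_leP: xi1.
- have [ze0|ze0] := pselect (ze = ord_zero).
    by rewrite xiE ze0; apply: schreier_one; rewrite cardfs1; exact: min1.
  rewrite xiE; have -> : [fset a]%fset = (\big[fsetU/fset0]_(i < 1) [fset a])%fset.
    by rewrite big_ord1.
  apply: schreier_succ => //.
  + exact/ord_one_leP.
  + exact: min1.
  + by move=> i j; rewrite !ord1.
  + by move=> _; apply/fset0Pn; exists a; rewrite inE.
  + by move=> _; apply: IH => //; exact/ord_one_leP.
- have [_ /(_ 0%N)/andP[s1 sxi] _] := hs lxi.
  apply: (@schreier_lim _ _ 0%N) => //.
  + by apply/fset0Pn; exists a; rewrite inE.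
  + exact: min1.
  + exact: IH.
Qed.

Variables (W : set (seq nat)) (rk : seq nat -> omega1).
Hypothesis rkW : is_rank W rk.
Variables (node : seq nat -> seq nat) (letter : seq nat -> nat -> nat).
Hypothesis nodeS : forall l a, node (rcons l a) = rcons (node l) (letter l a).

Lemma schreier_rank_le xi N l : (ord_one <= xi)%O ->
  (forall t, sorted ltn t -> all (ltn N) t -> schreier s xi [fset x in t]%fset ->
     W (node (l ++ t))) ->
  (xi <= rk (node l))%O.
Proof.
elim/omega1_ind: xi N l => xi IH N l xi1 Wl.
have fset1E (a : nat) : [fset x in [:: a]]%fset = [fset a]%fset.
  by apply/fsetP => b; rewrite !inE orbF.
have sub1 a : (N < a)%N -> (rk (node (rcons l a)) < rk (node l))%O.
  move=> Na; rewrite nodeS; apply: (is_rank_lt rkW); rewrite -nodeS -cats1.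
  apply: Wl => //=; first by rewrite Na.
  by rewrite fset1E; apply: schreier_fset1 => //; exact: leq_ltn_trans Na.
have [xi0|[ze zexi xiE]|lxi] := ord_trichotomy xi.
- by move/ord_one_leP: xi1.
(* The letter [N.+2] is at least 2, so its singleton may be joined to one set of the family of index
   [ze] lying beyond it. *)
- rewrite xiE; apply/ord_succ_ltP; apply: le_lt_trans (sub1 N.+2 _) => //.
  have [->|ze0] := pselect (ze = ord_zero); first exact: ord_zero_le.
  apply: (IH _ zexi N.+2); first exact/ord_one_leP.
  move=> t st Nt tze; rewrite -cats1 -catA; apply: Wl => /=.
  + by rewrite path_sortedE ?Nt//; exact: ltn_trans.
  + by rewrite leqnSn /=; apply: sub_all Nt => b /= /ltnW/ltnW.
  + case: t st Nt tze => [|b t] st Nt tze.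
      by rewrite fset1E; exact: schreier_fset1.
    pose G (i : 'I_2) := (if i == ord0 then [fset N.+2] else [fset x in b :: t])%fset.
    have -> : [fset x in N.+2 :: b :: t]%fset = (\big[fsetU/fset0]_(i < 2) G i)%fset.
      rewrite big_ord_recl big_ord1 /G /=; apply/fsetP => c.
      by rewrite !inE.
    rewrite xiE; apply: schreier_succ.
    * exact/ord_one_leP.
    * by move=> c; rewrite /G /= inE => /eqP ->.
    * move=> [[|[|//]] i2] [[|[|//]] j2] //= _ c c'; rewrite /G /= !inE => /eqP ->.
      move=> h; apply: (allP Nt); by rewrite inE.
    * move=> i; rewrite /G; case: ifP => _; apply/fset0Pn; first by exists N.+2; rewrite inE.
      by exists b; rewrite !inE eqxx.
    * move=> i; rewrite /G; case: ifP => _ //.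
      by apply: schreier_fset1 => //; exact/ord_one_leP.
- have [_ sxi [_ sup]] := hs lxi; apply: sup => _ [n _ <-].
  have /andP[s1 sx] := sxi n.
  (* Beyond [n], sets of the family of index [s xi n] belong to that of index [xi]. *)
  apply: (IH _ sx (maxn N n)) => // t st Nt ts; apply: Wl => //.
    by apply: sub_all Nt => b /=; rewrite gtn_max => /andP[].
  case: t st Nt ts => [|b t] st Nt ts.
    rewrite (_ : [fset x in [::]]%fset = fset0); first exact: schreier_empty.
    by apply/fsetP => b; rewrite !inE.
  apply: (@schreier_lim _ _ n) => //.
    by apply/fset0Pn; exists b; rewrite !inE eqxx.
  move=> c; rewrite !inE => h; have /(allP Nt) : c \in b :: t by rewrite inE.
  by rewrite /= gtn_max => /andP[].
Qed.

End schreier_rank.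

(** * Schreier families inside the tree of an operator *)

Section schreier_strict_singularity.
Variables (R : realType) (X Y : completeNormedModType R) (d : nat -> X).
Hypothesis dX : forall x (e : R), 0 < e -> exists n, ball x e (d n).
Variables (s : omega1 -> nat -> omega1) (hs : fundamental_sequences s).

(** The failing basic sequence is rescaled to a [spread] one. Rescaling does not change the spans,
    on which [T] is bounded below along Schreier sets. *)
Lemma not_schreier_strictly_singular_tree (T : operators X Y) xi :
  ~ schreier_strictly_singular s xi (ap T) ->
  exists q phi, forall t, sorted ltn t -> all (ltn 0%N) t ->
    schreier s xi [fset x in t]%fset ->
    ss_tree d (ap T) (q :: seq_map phi (map predn t)).
Proof.
move=> /existsNP[x /not_implyP[x1 /not_implyP[bx /existsNP[e /not_implyP[e0 nF]]]]].
have x0 n : x n != 0 by rewrite -normr_eq0 x1 oner_eq0.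
have [c c0 sz] := independent_spread (basic_sequence_independent x0 bx).
have [ee eeP] := dense_approx dX (fun n => c n *: x n).
have [q qT qe] := op_index T e0.
exists q, (approx_letter ee) => t st t0 tS.
apply: (ss_tree_approx sz eeP qT).
  (* The shift from indices starting at 1 is strictly increasing because the members of [t] are
     positive. *)
  by apply: (homo_sorted_in _ t0 st) => -[|b] [|b'].
move=> a /=; set v := comb _ _ _.
have [->|v0] := eqVneq v 0; first by rewrite normr0 mulr0.
have nv0 : 0 < `|v| by rewrite normr_gt0.
have : ~ (`|ap T (`|v|^-1 *: v)| <= e).
  move=> Tv; apply: nF; exists [fset x in t]%fset; split=> //.
    apply/fset0Pn; move: v0; rewrite /v; case: t {st t0 tS v Tv nv0} => [|b t].
      by rewrite /comb big_ord0 eqxx.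
    by move=> _; exists b; rewrite !inE eqxx.
  exists (`|v|^-1 *: v); split=> //; last first.
    by rewrite normrZ normfV normr_id mulVf// gt_eqF.
  exists (size t), (fun i => `|v|^-1 * (a i * c (nth 0%N (map predn t) i))).
  exists (fun i => x (nth 0%N (map predn t) i)); split=> [i|].
    exists (nth 0%N t i); last by rewrite (nth_map 0%N).
    by rewrite /= !inE mem_nth.
  rewrite /v /comb size_map scaler_sumr; apply: eq_bigr => i _.
  by rewrite !scalerA mulrA.
move/negP; rewrite -ltNge apZ normrZ normfV normr_id ltr_pdivlMl// => /ltW.
by apply: le_trans; rewrite mulrC ler_wpM2l.
Qed.

(** Take for [xi] the rank of the root itself. If [T] failed to be strictly singular for this
    family, its copy above some [[:: q]] would give [xi <= rk [:: q] < rk [::] = xi]. *)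
Lemma rho_le_tree_rank (T : operators X Y) : wf_tree (ss_tree d (ap T)) ->
  (rho s (ap T) <= tree_rank (ss_tree d (ap T)) :> omega1c)%O.
Proof.
move=> wT; have [rk rkP ->] := tree_rankP (ss_tree_tree d (ap T)) wT.
have rk1 q : (rk [:: q] < rk [::])%O.
  by apply: (is_rank_lt rkP (_ : ss_tree d (ap T) (rcons [::] q))); split.
have one : (ord_one <= rk [::])%O.
  by apply/ord_succ_ltP; apply: le_lt_trans (rk1 0%N); exact: ord_zero_le.
suff Tss : schreier_strictly_singular s (rk [::]) (ap T).
  rewrite /rho /ord_inf; case: pselect => [ne|]; last by case; exists (rk [::]).
  have [_ minle] := ord_minP ne; exact: minle.
apply: contrapT => /not_schreier_strictly_singular_tree[q [phi phiP]].
have := @schreier_rank_le s hs _ rk rkP (fun l => q :: seq_map phi (map predn l))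
  (fun l a => phi (map predn (rcons l a))) _ (rk [::]) 0%N [::] one phiP.
rewrite /= leNgt rk1 => h; suff : false by []; apply: h => l a.
by rewrite map_rcons seq_map_rcons.
Qed.

End schreier_strict_singularity.

Lemma SS_wf_tree (R : realType) (X Y : completeNormedModType R) (d : nat -> X) :
  (forall x (e : R), 0 < e -> exists n, ball x e (d n)) ->
  SS X Y = [set T : opspace X Y | wf_tree (ss_tree d (op_fun T))].
Proof.
move=> dX; apply/seteqP; split=> T /= TP; apply: contrapT.
  by move=> /ss_tree_branch; apply.
by move=> /(ss_tree_ill_founded dX); apply.
Qed.

Theorem theorem2 (R : realType) (X Y : completeNormedModType R)
    (s : omega1 -> nat -> omega1) (hs : fundamental_sequences s)
    (sepX : separable X) (sepY : separable Y)
    (infX : ~ finite_dimensional [set: X])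
    (infY : ~ finite_dimensional [set: Y]) :
  (exists r : SS X Y -> omega1, coanalytic_rank R r /\
     forall T : SS X Y, (rho s (op_fun (\val T)) <= r T :> omega1c)%O) /\
  (forall A : set (opspace X Y), analytic A -> A `<=` SS X Y ->
     (ord_sup [set rho s (op_fun T) | T in A] < ord_top)%O).
Proof.
have X0 : exists x : X, x != 0.
  apply: contrapT => /forallNP X0; apply: infX; exists set0 => //.
  apply/seteqP; split=> // x _; exists 0%N, (fun=> 0), (fun=> 0); split; first by case.
  by rewrite big_ord0; apply/eqP; apply: contrapT => /negP; exact: X0.
have [d dX] := dense_seq sepX.
have sb := opspace_standard_borel sepX sepY X0.
have [g [mg gT]] := standard_borel_surjection sb.
pose W (T : opspace X Y) := ss_tree d (op_fun T).
have tW T : is_tree (W T) by exact: ss_tree_tree.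
have mW p : measurable [set T | W T p] by exact: measurable_ss_tree.
have rhoW (T : opspace X Y) : wf_tree (W T) ->
    (rho s (op_fun T) <= tree_rank (W T) :> omega1c)%O.
  exact: (rho_le_tree_rank dX hs).
rewrite (SS_wf_tree Y dX); split.
  exists (fun T => tree_rank (W (\val T))); split.
    exact: (coanalytic_rank_tree_rank mg gT tW mW sb).
  by move=> [T /= /set_mem TW]; exact: rhoW.
move=> A aA AW; have [xi xiP] := tree_rank_analytic_bounded tW mW aA AW.
(* The supremum is countable as soon as one countable upper bound exists. *)
rewrite /ord_sup /ord_inf; case: pselect => //; case; exists xi => _ [T AT <-].
by apply: le_trans (rhoW T (AW _ AT)) _; exact: xiP.
Qed.
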